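(* Let $(N,h,Z)$ be a lightlike manifold of dimension $m+1$, $m\ge2$, and let $(\mathcal T,\mathbf h,\nabla^{\mathcal T},\xi)$ be a lightlike extension vector bundle for $(N,h,Z)$, with associated maps $\nabla:\tau\mapsto\nabla^\tau$ and Galilean connections $\widetilde\nabla^\tau$, $\tau\in S(N,h,Z)$. Then the following statements are equivalent: (1) $R^{\mathcal T}(V,W)\xi$ is collinear with $\xi$ for every $V,W\in\mathfrak X(N)$. (2) For each $\tau\in S(N,h,Z)$, the map $\nabla$ satisfies: (2.1) $\nabla^\tau_ZX=X+P^\tau([Z,X])$ for every $X\in\Gamma(\mathrm{An}(\tau))$; (2.2) $\nabla^\tau_XY-\nabla^\tau_YX-P^\tau([X,Y])=0$ for every $X,Y\in\Gamma(\mathrm{An}(\tau))$. (3) For each $\tau\in S(N,h,Z)$, the Galilean connection $\widetilde\nabla^\tau$ satisfies $P^\tau\circ\widetilde{\mathrm{Tor}}^\tau=0$. In particular, the condition that $R^{\mathcal T}(V,W)\xi$ is collinear with $\xi$ for every $V,W\in\mathfrak X(N)$ uniquely determines the map $\nabla$ (i.e. any two lightlike extension vector bundles for $(N,h,Z)$ satisfying it have the same $\nabla^\tau$ for every $\tau$).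
   Context: Manifolds are smooth, Hausdorff, connected, second countable. A lightlike manifold $(N,h,Z)$ is an $(m+1)$-dimensional manifold with a symmetric positive semidefinite $(0,2)$-tensor $h$ whose radical $\{v:h(v,\cdot)=0\}$ is one-dimensional at each point and a vector field $Z$ spanning it everywhere. $S(N,h,Z)=\{\tau\in\Omega^1(N,\mathbb R):\tau(Z)=1\}$, $\mathrm{An}(\tau)=\ker\tau\subset TN$ (on which $h$ is positive definite), $P^\tau(v)=v-\tau(v)Z$. A lightlike extension vector bundle over $N$ is a quadruple $(\mathcal T,\mathbf h,\nabla^{\mathcal T},\xi)$: a real vector bundle $\mathcal T\to N$ of rank $m+2$ with a bundle metric $\mathbf h$ of Lorentzian signature, a linear connection $\nabla^{\mathcal T}$ with $\nabla^{\mathcal T}\mathbf h=0$, and a lightlike section $\xi$ such that $\Phi(W):=\nabla^{\mathcal T}_W\xi$ defines a vector bundle monomorphism $\Phi:TN\to\mathcal T$. Then $\Phi(TN)=\xi^\perp$. It is for $(N,h,Z)$ if $h(V,W)=\mathbf h(\Phi(V),\Phi(W))$ and $\Phi(Z)=\xi$. $R^{\mathcal T}(V,W)T=\nabla^{\mathcal T}_V\nabla^{\mathcal T}_WT-\nabla^{\mathcal T}_W\nabla^{\mathcal T}_VT-\nabla^{\mathcal T}_{[V,W]}T$. ''Collinear with $\xi$'' means equal to $f\xi$ for some function $f$ (possibly zero). For $\tau\in S(N,h,Z)$ let $\eta^\tau$ be the unique lightlike section of $\mathcal T$ with $\mathbf h(\xi,\eta^\tau)=1$ and $\mathbf h(\Phi(\mathrm{An}(\tau)),\eta^\tau)=0$;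 every section of $\mathcal T$ is uniquely $\alpha\xi+\Phi(X)+\beta\eta^\tau$ with $X\in\Gamma(\mathrm{An}(\tau))$. For $X\in\Gamma(\mathrm{An}(\tau))$, $W\in\mathfrak X(N)$, $\nabla^\tau_WX$ is the $\mathrm{An}(\tau)$-component of $\nabla^{\mathcal T}_W\Phi(X)$; this is a metric linear connection on $(\mathrm{An}(\tau)\to N,h)$. The associated Galilean connection on $N$ is $$\widetilde\nabla^\tau_VW=V(\tau(W))Z+\tau(W)P^\tau(V)+\nabla^\tau_V(P^\tau(W)),$$ with torsion $\widetilde{\mathrm{Tor}}^\tau(V,W)=\widetilde\nabla^\tau_VW-\widetilde\nabla^\tau_WV-[V,W]$. *)

(* Defs.v *)
From mathcomp Require Import all_boot all_order all_algebra.
From mathcomp Require Import all_classical all_reals all_analysis.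

Set Implicit Arguments.
Unset Strict Implicit.
Unset Printing Implicit Defensive.

Import Order.TTheory GRing.Theory Num.Theory.
Import numFieldNormedType.Exports.
Local Open Scope classical_set_scope.
Local Open Scope ring_scope.

(** * Smooth maps between open subsets of Euclidean spaces *)

(* Meant for open [U]; then all notions below depend only on [f] restricted to
   [U]. [f] is C^(k+1) iff it is Frechet differentiable with all directional
   derivatives of class C^k. *)
Fixpoint Ck_on {R : realType} {n : nat} {W : normedModType R} (k : nat)
    (U : set 'rV[R]_n) (f : 'rV[R]_n -> W) : Prop :=
  match k with
  | 0 => forall x, U x -> {for x, continuous f}
  | k'.+1 => (forall x, U x -> differentiable f x) /\
             (forall v, Ck_on k' U ('D_v f))
  end.

Definition smooth_on {R : realType} {n : nat} {W : normedModType R}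
    (U : set 'rV[R]_n) (f : 'rV[R]_n -> W) : Prop :=
  forall k, Ck_on k U f.

(** * Smooth manifolds *)

(* A homeomorphism from the open set [cdom] onto an open subset of R^n; outside
   [cdom] and its image, [cmap] and [cinv] take irrelevant values. *)
Record chart (R : realType) (n : nat) (N : topologicalType) := Chart {
  cdom : set N;
  cmap : N -> 'rV[R]_n;
  cinv : 'rV[R]_n -> N;
  cdom_open : open cdom;
  cimg_open : open (cmap @` cdom);
  cmap_continuous : forall p, cdom p -> {for p, continuous cmap};
  cinv_continuous : forall x, (cmap @` cdom) x -> {for x, continuous cinv};
  cmapK : forall p, cdom p -> cinv (cmap p) = p
}.

(* [chart_at p] is a preferred chart around [p]. *)
Record manifold (R : realType) (n : nat) := Manifold {
  points :> topologicalType;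
  manifold_hausdorff : hausdorff_space points;
  manifold_second_countable : @second_countable points;
  manifold_connected : connected [set: points];
  atlas : set (chart R n points);
  chart_at : points -> chart R n points;
  chart_at_atlas : forall p, atlas (chart_at p);
  chart_at_dom : forall p, cdom (chart_at p) p;
  transition_smooth : forall c c', atlas c -> atlas c' ->
    smooth_on (cmap c @` (cdom c `&` cdom c')) (cmap c' \o cinv c)
}.

Section Manifold.
Context {R : realType} {n : nat} {N : manifold R n}.

Definition smooth_map_on {W : normedModType R} (A : set N) (f : N -> W) : Prop :=
  forall c, atlas c -> smooth_on (cmap c @` (cdom c `&` A)) (f \o cinv c).

Definition smooth_fun (f : N -> R) : Prop := smooth_map_on setT f.

End Manifold.

(** * Vector bundles *)

(* A real vector bundle of rank [k], presented by its fibers and a family of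
   local trivializations [triv i] with inverses [untriv i], over the sets
   [base i]. The total space carries the topology and smooth structure for
   which these trivializations are diffeomorphisms, so that smoothness of
   sections and of tensors is smoothness of their local components. *)
Record bundle_data (R : realType) (n : nat) (N : manifold R n) (k : nat) :=
  BundleData {
    fiber :> N -> lmodType R;
    triv_index : Type;
    base : triv_index -> set N;
    triv : triv_index -> forall p, fiber p -> 'rV[R]_k;
    untriv : triv_index -> forall p, 'rV[R]_k -> fiber p
  }.

Record is_vector_bundle (R : realType) (n : nat) (N : manifold R n) (k : nat)
    (B : bundle_data N k) : Prop := IsVectorBundle {
  base_open : forall i : triv_index B, open (base i);
  base_cover : forall p : N, exists i : triv_index B, base i p;
  triv_linear : forall (i : triv_index B) p, base i p -> linear (triv i (p := p));
  trivK : forall (i : triv_index B) p, base i p ->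
    cancel (triv i (p := p)) (untriv i p);
  untrivK : forall (i : triv_index B) p, base i p ->
    cancel (untriv i p) (triv i (p := p));
  triv_smooth : forall (i j : triv_index B) (w : 'rV[R]_k),
    smooth_map_on (base i `&` base j) (fun p => triv j (untriv i p w))
}.

Section Bundle.
Context {R : realType} {n : nat} {N : manifold R n} {k : nat}.
Variable B : bundle_data N k.

Definition section := forall p : N, B p.
Definition oneform := forall p : N, B p -> R.
Definition twoform := forall p : N, B p -> B p -> R.

Definition smooth_section (s : section) : Prop :=
  forall i : triv_index B, smooth_map_on (base i) (fun p => triv i (s p)).

Definition smooth_oneform (t : oneform) : Prop :=
  (forall p, scalar (t p)) /\
  forall (i : triv_index B) (w : 'rV[R]_k),
    smooth_map_on (base i) (fun p => t p (untriv i p w)).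

Definition smooth_symmetric_form (H : twoform) : Prop :=
  [/\ forall p x, scalar (H p x),
      forall p x y, H p x y = H p y x &
      forall (i : triv_index B) (w w' : 'rV[R]_k),
        smooth_map_on (base i) (fun p => H p (untriv i p w) (untriv i p w'))].

End Bundle.

(* Signature (-, +, ..., +): each fiber has a basis [e] that is orthonormal in
   the Lorentzian sense. *)
Definition lorentzian_metric (R : realType) (n : nat) (N : manifold R n)
    (k : nat) (B : bundle_data N k.+1) (H : twoform B) : Prop :=
  smooth_symmetric_form H /\
  forall p, exists e : 'I_k.+1 -> B p,
    (forall x, exists a : 'I_k.+1 -> R, x = \sum_i a i *: e i) /\
    (forall i j, H p (e i) (e j) =
       if i == j then (if i == ord0 then -1 else 1) else 0).

(** * The tangent bundle *)

Section Tangent.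
Context {R : realType} {n : nat}.
Variable N : manifold R n.

(* A tangent vector at [p] is given by its components in [chart_at p]. *)
Definition tangent (p : N) : lmodType R := 'rV[R]_n.

(* Components in the chart [c] of a tangent vector at [p], and conversely, by
   the differential of the transition map between [chart_at p] and [c]. *)
Definition to_coord (c : chart R n N) (p : N) (v : tangent p) : 'rV[R]_n :=
  'd (cmap c \o cinv (chart_at p)) (cmap (chart_at p) p) v.

Definition of_coord (c : chart R n N) (p : N) (w : 'rV[R]_n) : tangent p :=
  'd (cmap (chart_at p) \o cinv c) (cmap c p) w.

Definition tangent_bundle : bundle_data N n :=
  {| fiber := tangent;
     triv_index := {c : chart R n N | atlas c};
     base := fun c => cdom (sval c);
     triv := fun c p v => @to_coord (sval c) p v;
     untriv := fun c p w => of_coord (sval c) p w |}.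

Definition vfield := section tangent_bundle.
Definition smooth_vfield (V : vfield) : Prop := smooth_section V.

(* [dfun f (V p)] is (V f)(p). *)
Definition dfun (f : N -> R) (p : N) (v : tangent_bundle p) : R :=
  'd (f \o cinv (chart_at p)) (cmap (chart_at p) p) v.

Definition coord_vfield (c : chart R n N) (V : vfield) : 'rV[R]_n -> 'rV[R]_n :=
  fun x => @to_coord c (cinv c x) (V (cinv c x)).

(* [V, W]^i = V^j d_j W^i - W^j d_j V^i in the coordinates of [chart_at p];
   these are the components of the bracket in that chart. *)
Definition lie_bracket (V W : vfield) : vfield := fun p =>
  let c := chart_at p in
  let x := cmap c p in
  'd (coord_vfield c W) x (coord_vfield c V x)
  - 'd (coord_vfield c V) x (coord_vfield c W x).

End Tangent.

(** * Linear connections *)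

Section Connection.
Context {R : realType} {n : nat} {N : manifold R n} {k : nat}.
Variable B : bundle_data N k.

(* [D s p v] is the covariant derivative at [p] of the section [s] in the
   direction [v]; it is only meaningful for smooth [s]. *)
Definition cov_derivation := section B -> forall p : N, tangent_bundle N p -> B p.

Definition cov (D : cov_derivation) (V : vfield N) (s : section B) : section B :=
  fun p => D s p (V p).

Record is_connection (D : cov_derivation) : Prop := IsConnection {
  connection_linear : forall s p, smooth_section s -> linear (D s p);
  connection_smooth : forall V s, smooth_vfield V -> smooth_section s ->
    smooth_section (cov D V s);
  connection_add : forall (s t : section B) p v,
    smooth_section s -> smooth_section t ->
    D (fun q => s q + t q) p v = D s p v + D t p v;
  connection_leibniz : forall (f : N -> R) (s : section B) p v,
    smooth_fun f -> smooth_section s ->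
    D (fun q => f q *: s q) p v = dfun f v *: s p + f p *: D s p v
}.

Definition metric_connection (H : twoform B) (D : cov_derivation) : Prop :=
  forall (s t : section B) p (v : tangent_bundle N p),
    smooth_section s -> smooth_section t ->
    dfun (fun q => H q (s q) (t q)) v = H p (D s p v) (t p) + H p (s p) (D t p v).

Definition curvature (D : cov_derivation) (V W : vfield N) (s : section B) :
    section B := fun p =>
  cov D V (cov D W s) p - cov D W (cov D V s) p - cov D (lie_bracket V W) s p.

End Connection.

(** * Lightlike manifolds *)

Section Lightlike.
Context {R : realType} {n : nat} {N : manifold R n}.
Notation TN := (tangent_bundle N).

Definition is_lightlike_manifold (h : twoform TN) (Z : vfield N) : Prop :=
  [/\ smooth_symmetric_form h,
      smooth_vfield Z,
      forall p (v : TN p), 0 <= h p v v,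
      forall p, Z p != 0 &
      forall p (v : TN p),
        (forall w : TN p, h p v w = 0) <-> (exists a : R, v = a *: Z p)].

Definition Sforms (Z : vfield N) (tau : oneform TN) : Prop :=
  smooth_oneform tau /\ forall p, tau p (Z p) = 1.

Definition Anfield (tau : oneform TN) (X : vfield N) : Prop :=
  smooth_vfield X /\ forall p, tau p (X p) = 0.

Definition Pproj (Z : vfield N) (tau : oneform TN) (V : vfield N) : vfield N :=
  fun p => V p - tau p (V p) *: Z p.

End Lightlike.

(** * Lightlike extension vector bundles *)

(* The quadruple (T, h, nabla^T, xi) over a manifold of dimension [n]; the
   rank of T is [n.+1]. *)
Record extension_data (R : realType) (n : nat) (N : manifold R n) :=
  ExtensionData {
    ext_bundle : bundle_data N n.+1;
    ext_metric : twoform ext_bundle;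
    ext_conn : cov_derivation ext_bundle;
    ext_xi : section ext_bundle
  }.

Arguments ext_metric {R n N} e p x y.
Arguments ext_conn {R n N} e s p v.
Arguments ext_xi {R n N} e p.

Section Extension.
Context {R : realType} {n : nat} {N : manifold R n}.
Variable E : extension_data N.
Notation TN := (tangent_bundle N).
Notation T := (ext_bundle E).
Notation H := (ext_metric E).
Notation D := (ext_conn E).
Notation xi := (ext_xi E).

Definition lightlike p (x : T p) : Prop := x != 0 /\ H p x x = 0.

Definition Phi (p : N) (v : TN p) : T p := D xi p v.

Definition Phifield (X : vfield N) : section T := fun p => Phi (X p).

Record is_lightlike_extension : Prop := IsLightlikeExtension {
  ext_vector_bundle : is_vector_bundle T;
  ext_lorentzian : lorentzian_metric H;
  ext_connection : is_connection D;
  ext_metric_connection : metric_connection H D;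
  ext_xi_smooth : smooth_section xi;
  ext_xi_lightlike : forall p, lightlike (xi p);
  ext_mono : forall p, injective (Phi (p := p))
}.

Definition extends (h : twoform TN) (Z : vfield N) : Prop :=
  (forall p (v w : TN p), h p v w = H p (Phi v) (Phi w)) /\
  (forall p, Phi (Z p) = xi p).

(* [xget 0] selects the unique solution in each fiber; pointwise uniqueness
   makes the resulting section smooth. *)
Definition eta (tau : oneform TN) : section T := fun p =>
  xget 0 [set y : T p | [/\ lightlike y, H p (xi p) y = 1 &
                            forall v : TN p, tau p v = 0 -> H p (Phi v) y = 0]].

(* The component in An(tau) of [y : T p] in the splitting of [T p] as the
   direct sum of R xi, Phi(An(tau)) and R eta^tau. *)
Definition An_component (tau : oneform TN) (p : N) (y : T p) : TN p :=
  xget 0 [set x : TN p | tau p x = 0 /\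
            exists a b : R, y = a *: xi p + Phi x + b *: eta tau p].

Definition nabla (tau : oneform TN) (W X : vfield N) : vfield N :=
  fun p => An_component tau (cov D W (Phifield X) p).

Definition galilean (Z : vfield N) (tau : oneform TN) (V W : vfield N) :
    vfield N := fun p =>
  dfun (fun q => tau q (W q)) (V p) *: Z p
  + tau p (W p) *: Pproj Z tau V p
  + nabla tau V (Pproj Z tau W) p.

Definition torsion (Z : vfield N) (tau : oneform TN) (V W : vfield N) :
    vfield N := fun p =>
  galilean Z tau V W p - galilean Z tau W V p - lie_bracket V W p.

Definition curvature_xi_collinear : Prop :=
  forall V W, smooth_vfield V -> smooth_vfield W ->
  exists f : N -> R, forall p, curvature D V W xi p = f p *: xi p.

End Extension.

(* Main.v *)
(* By metric compatibility H(xi, R(V,W) xi) = 0, and the An(tau)-component of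
   R(V,W) xi = D_V Phi(W) - D_W Phi(V) - Phi([V,W]) is P^tau(Tor(V,W)); hence
   R(V,W) xi is collinear with xi iff P^tau(Tor(V,W)) = 0, for any one tau.
   For W = X in An(tau) and V = Z or V in An(tau), this is (2.1) or (2.2), and
   these two cases imply the general one, since P^tau(Tor(V,W)) is tensorial.
   Going from (3) back to (1) requires S(N,h,Z) to be nonempty, i.e. smooth
   cutoff functions and a countable gluing argument. Uniqueness is that of a
   metric torsion-free connection. *)

From HB Require Import structures.
Require Import Defs.
From mathcomp Require Import all_boot all_order all_algebra.
From mathcomp Require Import all_classical all_reals all_analysis.
From mathcomp Require Import ring.

Set Implicit Arguments.
Unset Strict Implicit.
Unset Printing Implicit Defensive.

Import Order.TTheory GRing.Theory Num.Theory.
Import numFieldNormedType.Exports.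
Local Open Scope classical_set_scope.
Local Open Scope ring_scope.

(** * Functions of class C^k on open sets *)

(** Covariant derivatives apply to global smooth sections, so local objects must be extended to all
    of [N]: a local one-form on the way to [tau], and a single tangent vector for uniqueness, where
    the difference of the two connections is tested against its own value at a point. Both
    extensions multiply by a cutoff function supported in a compact part of a chart domain, which is
    closed because [N] is Hausdorff. [eta] and the An-component are chosen separately in each fiber
    and are treated by linear algebra in that fiber: injectivity of [Phi] and nondegeneracy of the
    metric give a vector representing [tau], and a dimension count gives the splitting. Derivatives
    fall only on [xi], on sections [Phi(W)], and on functions and fields on [N]. Tensoriality is
    used in one concrete form: with [V = tau(V) Z + P V], the derivatives of [tau(V)] in a bracket
    multiply [Z], and [P] removes them. *)

Lemma near_eq_diff (R : numFieldType) (V W : normedModType R) (f g : V -> W) x :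
  (\near x, f x = g x) -> differentiable f x ->
  differentiable g x /\ 'd g x = 'd f x :> (V -> W).
Proof.
move=> fg df.
have gx : g x = f x by rewrite (nbhs_singleton fg).
have E : g \o shift x = cst (g x) + 'd f x +o_ 0 id.
  have /eqaddoP hdf := diff_locally df.
  apply/eqaddoP => e e0; have /nbhs0P fg0 := fg.
  by apply: filterS2 fg0 (hdf e e0) => y; rewrite !fctE /= gx [y + x]addrC => ->.
have dg : 'd g x = 'd f x :> (V -> W) by apply: diff_unique => //; exact: diff_continuous.
split => //; apply/diff_locallyP; rewrite dg; split => //; exact: diff_continuous.
Qed.

Section Ck.
Context {R : realType} {n : nat}.
Implicit Types (W : normedModType R) (U V : set 'rV[R]_n).

Lemma Ck_sub W k U V (f : 'rV[R]_n -> W) : V `<=` U -> Ck_on k U f -> Ck_on k V f.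
Proof.
move=> VU; elim: k f => [|k IH] f /=; first by move=> H x Vx; apply/H/VU.
by case=> H1 H2; split => [x /VU /H1//|v]; exact: IH.
Qed.

Lemma Ck_bigcup W (I : Type) k (U : I -> set 'rV[R]_n) (f : 'rV[R]_n -> W) :
  (forall i, Ck_on k (U i) f) -> Ck_on k (\bigcup_i U i) f.
Proof.
elim: k f => [|k IH] f H /=; first by move=> x [i _] /(H i).
split => [x [i _ Ux]|v]; first by case: (H i) => + _; apply.
by apply: IH => i; have [_ Hv] := H i; exact: Hv.
Qed.

Lemma Ck_cst W k U (w : W) : Ck_on k U (fun=> w).
Proof.
elim: k w => [|k IH] w /=; first by move=> x _; exact: cst_continuous.
split => [x _|v]; first exact: differentiable_cst.
rewrite (_ : 'D_v _ = fun=> 0); first exact: IH.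
by apply/funext => x; rewrite derive_cst.
Qed.

(** Openness of [U] turns equality on [U] into equality near each point, which all derivatives
    respect. Later results use this to replace a function by a formula valid only on a chart. *)
Lemma Ck_ext W k U (f g : 'rV[R]_n -> W) : open U -> {in U, f =1 g} ->
  Ck_on k U f -> Ck_on k U g.
Proof.
move=> oU.
have near_fg (f' g' : 'rV[R]_n -> W) x : {in U, f' =1 g'} -> U x -> \near x, f' x = g' x.
  move=> fg Ux; apply: (@filterS _ (nbhs x) _ U); last exact: open_nbhs_nbhs.
  by move=> y Uy; rewrite fg// inE.
elim: k f g => [|k IH] f g fg.
  move=> Cf x Ux; rewrite /prop_for /continuous_at -fg ?inE//.
  exact: cvg_trans (near_eq_cvg (near_fg _ _ x fg Ux)) (Cf x Ux).
move=> [df Cf]; split => [x Ux|v].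
  by case: (near_eq_diff (near_fg _ _ x fg Ux) (df x Ux)).
apply: IH (Cf v) => x /set_mem Ux.
exact/near_eq_derive/near_fg.
Qed.

Lemma CkW W k U (f : 'rV[R]_n -> W) : Ck_on k.+1 U f -> Ck_on k U f.
Proof.
elim: k f => [|k IH] f /=.
  by move=> [df _] x Ux; exact/differentiable_continuous/df.
by move=> [df Cf]; split => // v; exact: IH.
Qed.

Lemma Ck_lin W W' k U (L : {linear W -> W'}) (f : 'rV[R]_n -> W) :
  open U -> continuous L -> Ck_on k U f -> Ck_on k U (L \o f).
Proof.
move=> oU cL; elim: k f => [|k IH] f /=.
  by move=> Cf x Ux; apply: continuous_comp; [exact: Cf|exact: cL].
move=> [df Cf]; have dL x : differentiable L x by exact: linear_differentiable.
split => [x Ux|v]; first by apply: differentiable_comp; [exact: df|].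
apply: (Ck_ext oU) (IH _ (Cf v)) => x /set_mem Ux /=.
have dfx := df _ Ux.
rewrite !deriveE//; last exact: differentiable_comp.
by rewrite (diff_comp dfx (dL _)) /= diff_lin.
Qed.

Lemma Ck_add W k U (f g : 'rV[R]_n -> W) :
  open U -> Ck_on k U f -> Ck_on k U g -> Ck_on k U (fun x => f x + g x).
Proof.
move=> oU; elim: k f g => [|k IH] f g.
  by move=> Cf Cg x Ux; exact: continuousD (Cf x Ux) (Cg x Ux).
move=> [df Cf] [dg Cg]; split => [x Ux|v].
  by apply: differentiableD; [exact: df|exact: dg].
apply: (Ck_ext oU) (IH _ _ (Cf v) (Cg v)) => x /set_mem Ux /=.
by rewrite -[LHS]deriveD//; apply: diff_derivable; [exact: df|exact: dg].
Qed.

Lemma Ck_sum W k U (I : Type) (r : seq I) (f : I -> 'rV[R]_n -> W) :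
  open U -> (forall i, Ck_on k U (f i)) -> Ck_on k U (fun x => \sum_(i <- r) f i x).
Proof.
move=> oU Cf; elim: r => [|i r IH].
  by rewrite (_ : (fun x => _) = fun=> 0); [exact: Ck_cst|apply/funext => x; rewrite big_nil].
rewrite (_ : (fun x => _) = fun x => f i x + \sum_(i <- r) f i x).
  exact: Ck_add.
by apply/funext => x; rewrite big_cons.
Qed.

Lemma Ck_mul k U (f g : 'rV[R]_n -> R) :
  open U -> Ck_on k U f -> Ck_on k U g -> Ck_on k U (fun x => f x * g x).
Proof.
move=> oU; elim: k f g => [|k IH] f g.
  by move=> Cf Cg x Ux; exact: continuousM (Cf x Ux) (Cg x Ux).
move=> Cf1 Cg1; have [Cf0 Cg0] := (CkW Cf1, CkW Cg1).
case: Cf1 Cg1 => [df Cf] [dg Cg]; split => [x Ux|v].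
  by apply: differentiableM; [exact: df|exact: dg].
have := Ck_add oU (IH _ _ Cf0 (Cg v)) (IH _ _ Cg0 (Cf v)).
apply: Ck_ext => // x /set_mem Ux /=.
by rewrite -[LHS]deriveM//; apply: diff_derivable; [exact: df|exact: dg].
Qed.

(** The derivative of [1/f] is [- (1/f)^2 Df], so the induction hypothesis for [1/f] itself supplies
    the factors. *)
Lemma Ck_inv k U (f : 'rV[R]_n -> R) :
  open U -> (forall x, U x -> f x != 0) -> Ck_on k U f ->
  Ck_on k U (fun x => (f x)^-1).
Proof.
move=> oU f0; elim: k => [|k IH].
  by move=> Cf x Ux; exact: continuousV (f0 x Ux) (Cf x Ux).
move=> Cf1; have Ci := IH (CkW Cf1); case: Cf1 => df Cf.
split => [x Ux|v].
  by apply: differentiableV; [exact: df|exact: f0].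
have := Ck_mul oU (Ck_mul oU (Ck_cst k U (-1 : R)) (Ck_mul oU Ci Ci)) (Cf v).
apply: Ck_ext => // x /set_mem Ux /=.
rewrite [RHS]deriveV//; [|exact: f0|exact/diff_derivable/df].
by rewrite mulN1r -expr2 exprVn.
Qed.

End Ck.

Lemma Ck_rowP (R : realType) n m k (U : set 'rV[R]_n) (f : 'rV[R]_n -> 'rV[R]_m) :
  open U -> Ck_on k U f <-> forall j, Ck_on k U (fun x => f x 0 j).
Proof.
move=> oU; split => [Cf j|Cf].
  have L : linear (fun v : 'rV[R]_m => v 0 j).
    by move=> a u v; rewrite !mxE.
  pose Lm := GRing.isLinear.Build _ _ _ _ _ L.
  pose LL : {linear 'rV[R]_m -> R} := HB.pack (fun v : 'rV[R]_m => v 0 j : R) Lm.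
  exact: (@Ck_lin _ _ _ _ _ _ LL f oU (@coord_continuous _ _ _ _ _) Cf).
have -> : f = fun x => \sum_j f x 0 j *: delta_mx 0 j.
  by apply/funext => x; exact: row_sum_delta.
apply: Ck_sum => // j.
have L : linear (fun a : R => a *: (delta_mx 0 j : 'rV[R]_m)).
  by move=> a u v; rewrite scalerDl scalerA.
pose Lm := GRing.isLinear.Build _ _ _ _ _ L.
pose LL : {linear R -> 'rV[R]_m} := HB.pack (fun a : R => a *: (delta_mx 0 j : 'rV[R]_m)) Lm.
apply: (@Ck_lin _ _ _ _ _ _ LL (fun x => f x 0 j)) => //.
exact: scalel_continuous.
Qed.

(** [Ck_on] speaks of derivatives in fixed directions, whereas the chain rule differentiates [g] in
    the moving direction ['D_v phi x]. Expanding that direction in the standard basis leaves a sum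
    of products of class C^k. *)
Lemma Ck_comp (R : realType) n m k (U : set 'rV[R]_n) (V : set 'rV[R]_m)
    (phi : 'rV[R]_n -> 'rV[R]_m) (g : 'rV[R]_m -> R) :
  open U -> open V -> (forall x, U x -> V (phi x)) ->
  Ck_on k U phi -> Ck_on k V g -> Ck_on k U (g \o phi).
Proof.
move=> oU oV UV; elim: k g => [|k IH] g.
  by move=> Cp Cg x Ux; apply: continuous_comp; [exact: Cp|exact/Cg/UV].
move=> Cp1; have Cp0 := CkW Cp1; case: Cp1 => dp Cp [dg Cg].
split => [x Ux|v].
  by apply: differentiable_comp; [exact: dp|exact/dg/UV].
have Cj j : Ck_on k U (fun x => 'D_v phi x 0 j * 'D_(delta_mx 0 j) g (phi x)).
  apply: Ck_mul => //; first by move: (Cp v) => /Ck_rowP; exact.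
  exact: (IH ('D_(delta_mx 0 j) g) Cp0 (Cg _)).
have := Ck_sum (index_enum 'I_m) oU Cj.
apply: Ck_ext => // x /set_mem Ux /=.
have dgx := dg _ (UV _ Ux); have dpx := dp _ Ux.
rewrite [RHS]deriveE; last exact: differentiable_comp.
rewrite (diff_comp dpx dgx) /= (row_sum_delta ('d phi x v)) linear_sum /=.
apply: eq_bigr => j _; rewrite linearZ /= !deriveE//.
Qed.

(** * Smooth bump functions *)

Section Flat.
Context {R : realType}.

(* The derivative of t^-j e^(-1/t) is a combination of two functions of the
   same form, so smoothness of the whole family is proved at once. *)
Definition flat (j : nat) (t : R) : R :=
  if 0 < t then t^-1 ^+ j * expR (- t^-1) else 0.

Lemma flat_le0 j t : t <= 0 -> flat j t = 0.
Proof. by rewrite /flat leNgt => /negbTE ->. Qed.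

Lemma flat_ge0 j t : 0 <= flat j t.
Proof.
rewrite /flat; case: ifP => // t0.
by rewrite mulr_ge0 ?expR_ge0// exprn_ge0// invr_ge0 ltW.
Qed.

Lemma flat_gt0 t : 0 < t -> 0 < flat 0 t.
Proof. by move=> t0; rewrite /flat t0 expr0 mul1r expR_gt0. Qed.

(** The quadratic bound makes the difference quotient at 0 tend to 0. With [y = 1/t] and
    [N = j + 2], it comes from [y/N <= 1 + y/N <= exp (y/N)] raised to the power [N]. *)
Lemma flat_bound j : exists C : R, forall t, flat j t <= C * t ^+ 2.
Proof.
pose N : R := j.+2%:R; exists (N ^+ j.+2) => t.
have N0 : 0 < N by rewrite ltr0n.
rewrite /flat; case: ifP => [t0|_]; last by rewrite mulr_ge0 ?sqr_ge0// exprn_ge0 ?ltW.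
set y := t^-1; have y0 : 0 < y by rewrite invr_gt0.
have H : (y / N) ^+ j.+2 <= expR y.
  rewrite -[in leRHS](mulfVK (lt0r_neq0 N0) y) expRM_natr.
  rewrite lerXn2r ?nnegrE ?expR_ge0 ?divr_ge0 ?ltW//.
  by rewrite (lt_le_trans _ (expR_ge1Dx _))// ltrDr.
rewrite expRN ler_pdivrMr ?expR_gt0//.
have -> : t = y^-1 by rewrite invrK.
rewrite -ler_pdivrMl; last by rewrite mulr_gt0// exprn_gt0// invr_gt0.
apply: le_trans H; rewrite le_eqVlt; apply/orP; left; apply/eqP.
by rewrite expr_div_n !exprS; field; rewrite !lt0r_neq0 ?exprn_gt0.
Qed.

Lemma is_derive_flat j (t : R) :
  is_derive t 1 (flat j) (flat j.+2 t - j%:R * flat j.+1 t).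
Proof.
have [t0|t0|->] := ltgtP t 0.
- rewrite !flat_le0 ?ltW// mulr0 subr0.
  apply: (@near_eq_is_derive _ _ _ (cst 0)).
  by near=> s; rewrite flat_le0// ltW//; near: s; exact: lt_nbhsl.
(* For positive arguments [flat j] is [g] composed with inversion. *)
- pose g (y : R) := y ^+ j * expR (- y).
  have dinv : is_derive t 1 (GRing.inv : R -> R) (- t ^- 2 *: 1).
    have tn0 : id t != 0 by rewrite lt0r_neq0.
    apply: DeriveDef; first exact: (derivableV tn0 (@derivable_id _ _ t 1)).
    by rewrite (deriveV tn0 (@derivable_id _ _ t 1)) derive_id.
  have dg (y : R) : is_derive y 1 g
      (y ^+ j *: (expR (- y) * -1) + expR (- y) *: (j%:R * y ^+ j.-1 *: 1)).
    have d1 : is_derive y 1 (fun y : R => y ^+ j) (j%:R * y ^+ j.-1 *: 1).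
      have := @is_deriveX _ _ id j y 1 1 (is_derive_id _ _).
      by rewrite exprfctE.
    have d2 : is_derive y 1 (fun y : R => expR (- y)) (expR (- y) * -1).
      exact: (@is_derive1_comp _ expR -%R).
    exact: is_deriveM.
  apply: (@near_eq_is_derive _ _ _ (g \o GRing.inv)).
    by near=> s; rewrite /flat /g /=; case: ifP => //; rewrite (near (lt_nbhsr t0) s).
  apply: is_derive_eq; rewrite /flat t0 /GRing.scale /=.
  case: j {g dg} => [|j] /=; rewrite !exprS !invfM ?expr0 ?invr1; ring.
- rewrite !flat_le0// mulr0 subr0.
  have [C HC] := flat_bound j.
  suff H : (fun h : R => h^-1 *: ((flat j \o shift 0) (h *: 1) - flat j 0)) @ 0^' --> (0:R).
    by apply: DeriveDef; [apply/cvg_ex; exists 0|exact: cvg_lim].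
  apply/cvgrPdist_le => e e0.
  near=> h.
  rewrite flat_le0// subr0 /= addr0 sub0r normrN normrM normfV.
  have h0 : h != 0 by near: h; exact: nbhs_dnbhs_neq.
  rewrite ler_pdivrMl ?normr_gt0// {1}/GRing.scale /= mulr1 ger0_norm ?flat_ge0//.
  (* The quotient is at most [C * |h|]; adding 1 to [|C|] makes the constant a positive divisor. *)
  have he : (`|C| + 1) * `|h| <= e.
    rewrite mulrC -ler_pdivlMr ?ltr_wpDl//.
    by near: h; apply: dnbhs0_le; rewrite divr_gt0 ?ltr_wpDl.
  rewrite (le_trans (HC h))// -[h ^+ 2]real_normK ?num_real// expr2 mulrA mulrC.
  rewrite ler_wpM2l// (le_trans _ he)// ler_wpM2r// (le_trans (ler_norm C))//.
  by rewrite lerDl.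
Unshelve. all: by end_near. Qed.

Lemma Ck_flat n k (U : set 'rV[R]_n) (u : 'rV[R]_n -> R) j :
  open U -> Ck_on k U u -> Ck_on k U (flat j \o u).
Proof.
move=> oU; have dflat i t : differentiable (flat i) t.
  by apply/derivable1_diffP; have [] := is_derive_flat i t.
elim: k j => [|k IH] j Cu.
  move=> x Ux; apply: continuous_comp; first exact: Cu.
  exact/differentiable_continuous/dflat.
have Cu0 := CkW Cu; case: Cu => du Cu; split => [x Ux|v].
  by apply: differentiable_comp; [exact: du|].
have Cf : Ck_on k U (fun x => (flat j.+2 (u x) + - j%:R * flat j.+1 (u x)) * 'D_v u x).
  apply: Ck_mul => //; last exact: Cu.
  apply: Ck_add => //; first exact: IH.
  by apply: Ck_mul => //; [exact: Ck_cst|exact: (IH j.+1)].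
apply: Ck_ext Cf => // x /set_mem Ux /=.
have dux := du _ Ux; rewrite [RHS]deriveE; last exact: differentiable_comp.
rewrite (diff_comp dux (dflat _ _)) /= (@diff1E _ _ _ _ (dflat j _)) derive1E.
have [_ ->] := is_derive_flat j (u x).
by rewrite deriveE// [RHS]mulrC mulNr.
Qed.

(** The denominator is positive because [t] and [1 - t] are never both nonpositive. *)
Definition smooth_step (t : R) : R := flat 0 t / (flat 0 t + flat 0 (1 - t)).

Lemma smooth_step_le0 t : t <= 0 -> smooth_step t = 0.
Proof. by move=> t0; rewrite /smooth_step flat_le0// mul0r. Qed.

Lemma smooth_step_ge1 t : 1 <= t -> smooth_step t = 1.
Proof.
move=> t1; rewrite /smooth_step [flat 0 (1 - t)]flat_le0 ?subr_le0// addr0.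
by rewrite divff// lt0r_neq0// flat_gt0// (lt_le_trans _ t1).
Qed.

Lemma Ck_smooth_step n k (U : set 'rV[R]_n) (u : 'rV[R]_n -> R) :
  open U -> Ck_on k U u -> Ck_on k U (smooth_step \o u).
Proof.
move=> oU Cu; apply: Ck_mul => //; first exact: Ck_flat.
have C1u : Ck_on k U (fun x => 1 - u x).
  have := Ck_add oU (Ck_cst k U (1 : R)) (Ck_mul oU (Ck_cst k U (-1 : R)) Cu).
  by apply: Ck_ext => // x _; rewrite mulN1r.
apply: Ck_inv => //; last first.
  by apply: Ck_add => //; [exact: Ck_flat|exact: (Ck_flat 0 oU C1u)].
move=> x _ /=; rewrite lt0r_neq0//.
have [u0|u0] := ltP 0 (u x).
  by rewrite ltr_pwDl ?flat_gt0 ?flat_ge0.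
by rewrite ltr_wpDl ?flat_ge0// flat_gt0// subr_gt0 (le_lt_trans u0).
Qed.

Lemma Ck_coord n k (U : set 'rV[R]_n) j : open U -> Ck_on k U (fun x : 'rV[R]_n => x 0 j : R).
Proof.
move=> oU; have Cid l : Ck_on l U (@id 'rV[R]_n).
  case: l => [|l]; first by move=> x _; exact: cvg_id.
  split => [x _|v]; first exact: ex_diff.
  rewrite (_ : 'D_v _ = fun=> v); first exact: Ck_cst.
  by apply/funext => x; rewrite derive_id.
exact: (Ck_rowP k (@id 'rV[R]_n) oU).1.
Qed.

Lemma smooth_bump n (x0 : 'rV[R]_n) (r : R) : 0 < r ->
  exists chi : 'rV[R]_n -> R, [/\ smooth_on setT chi,
    \forall x \near x0, chi x = 1 &
    forall x, r <= `|x - x0| -> chi x = 0].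
Proof.
move=> r0.
(* The norm on row vectors is the maximum norm, which is not smooth, so [u] uses the sum of squares.
   It is 2 at [x0], hence above 1 nearby. Where the maximum norm of [x - x0] is at least [r], one
   square is already at least [r ^+ 2], so [u] is at most 0. *)
pose u (x : 'rV[R]_n) := 2 + (- (2 / r ^+ 2)) * \sum_j (x 0 j - x0 0 j) * (x 0 j - x0 0 j).
have Cu k : Ck_on k setT u.
  have oT : open [set: 'rV[R]_n] := openT.
  apply: Ck_add => //; first exact: Ck_cst.
  apply: Ck_mul => //; first exact: Ck_cst.
  have Cj j : Ck_on k setT (fun x : 'rV[R]_n => x 0 j - x0 0 j).
    by apply: Ck_add => //; [exact: Ck_coord|exact: Ck_cst].
  by apply: Ck_sum => // j; apply: Ck_mul.
exists (smooth_step \o u); split.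
- by move=> k; apply: Ck_smooth_step => //; exact: openT.
- have u0 : u x0 = 2.
    by rewrite /u big1 ?mulr0 ?addr0// => j _; rewrite subrr mul0r.
  have : u @ x0 --> u x0 by exact: (Cu 0 x0 I).
  move=> /(_ [set t | 1 < t]); rewrite u0 => H.
  have {}H : \forall x \near x0, 1 < u x by apply: H; apply: lt_nbhsr; rewrite ltr1n.
  by near=> x; apply: smooth_step_ge1; apply/ltW; near: x.
- move=> x rx; apply: smooth_step_le0; rewrite /u mulNr subr_le0.
  have [j rj] : exists j, r <= `|x 0 j - x0 0 j|.
      move: rx; rewrite [`|_|]mx_normrE => /bigmax_geP [|[[i j] _ /=]].
      by rewrite leNgt r0.
    by rewrite !mxE (ord1 i); exists j.
  rewrite -mulrA ler_pMr// -ler_pdivrMl ?invr_gt0 ?exprn_gt0// invrK mulr1.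
  rewrite (bigD1 j)//= -expr2.
  rewrite (@le_trans _ _ (`|x 0 j - x0 0 j| ^+ 2))//.
    by rewrite lerXn2r ?nnegrE// ltW.
  rewrite real_normK ?num_real// lerDl sumr_ge0// => i _.
  by rewrite -expr2 sqr_ge0.
Unshelve. all: by end_near. Qed.

End Flat.

(** * Smooth maps and cutoff functions on a manifold *)

Section SmoothMaps.
Context {R : realType} {n : nat} {N : manifold R n}.
Implicit Types (A B O : set N) (c : chart R n N).

Lemma open_cmap_image c A : open A -> open (cmap c @` (cdom c `&` A)).
Proof.
move=> oA; rewrite openE => x [p [cp Ap] px]; subst x.
have cx : (cmap c @` cdom c) (cmap c p) by exists p.
have Hi := @cimg_open _ _ _ c; rewrite openE in Hi.
have H1 : nbhs (cmap c p) (cinv c @^-1` A).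
  by apply: (cinv_continuous cx); rewrite cmapK//; exact: open_nbhs_nbhs.
apply: filterS2 H1 (Hi _ cx) => y /= Ay [q cq qy]; subst y.
by exists q => //; split => //; rewrite cmapK// in Ay.
Qed.

Lemma smooth_map_sub (W : normedModType R) A B (f : N -> W) :
  B `<=` A -> smooth_map_on A f -> smooth_map_on B f.
Proof.
move=> BA Sf c ac k; apply: Ck_sub (Sf c ac k) => _ [p [cp Bp] <-].
by exists p => //; split => //; exact: BA.
Qed.

Lemma smooth_map_bigcup (W : normedModType R) (I : Type) (A : I -> set N) (f : N -> W) :
  (forall i, smooth_map_on (A i) f) -> smooth_map_on (\bigcup_i A i) f.
Proof.
move=> Sf c ac k; have := Ck_bigcup (fun i => Sf i c ac k).
by apply: Ck_sub => _ [p [cp [i _ Ap]] <-]; exists i => //; exists p.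
Qed.

Lemma smooth_map_ext (W : normedModType R) A (f g : N -> W) : open A ->
  (forall p, A p -> f p = g p) -> smooth_map_on A f -> smooth_map_on A g.
Proof.
move=> oA fg Sf c ac k; apply: Ck_ext (Sf c ac k); first exact: open_cmap_image.
by move=> x /set_mem [p [cp Ap] <-] /=; rewrite cmapK// fg.
Qed.

Lemma smooth_map_cst (W : normedModType R) A (w : W) : smooth_map_on A (fun=> w).
Proof. by move=> c ac k; exact: Ck_cst. Qed.

Lemma smooth_map_add (W : normedModType R) A (f g : N -> W) : open A ->
  smooth_map_on A f -> smooth_map_on A g -> smooth_map_on A (fun p => f p + g p).
Proof.
by move=> oA Sf Sg c ac k; apply: Ck_add (Sf c ac k) (Sg c ac k); exact: open_cmap_image.
Qed.

Lemma smooth_map_sum (W : normedModType R) A (I : Type) (r : seq I) (f : I -> N -> W) :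
  open A -> (forall i, smooth_map_on A (f i)) ->
  smooth_map_on A (fun p => \sum_(i <- r) f i p).
Proof.
move=> oA Sf c ac k; apply: (Ck_sum r) (fun i => Sf i c ac k).
exact: open_cmap_image.
Qed.

Lemma smooth_map_mul A (f g : N -> R) : open A ->
  smooth_map_on A f -> smooth_map_on A g -> smooth_map_on A (fun p => f p * g p).
Proof.
by move=> oA Sf Sg c ac k; apply: Ck_mul (Sf c ac k) (Sg c ac k); exact: open_cmap_image.
Qed.

Lemma smooth_map_inv A (f : N -> R) : open A -> (forall p, A p -> f p != 0) ->
  smooth_map_on A f -> smooth_map_on A (fun p => (f p)^-1).
Proof.
move=> oA f0 Sf c ac k; apply: Ck_inv (Sf c ac k); first exact: open_cmap_image.
by move=> _ [p [cp Ap] <-] /=; rewrite cmapK//; exact: f0.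
Qed.

Lemma smooth_map_rowP m A (f : N -> 'rV[R]_m) : open A ->
  smooth_map_on A f <-> forall j, smooth_map_on A (fun p => f p 0 j).
Proof.
move=> oA; have oc c := open_cmap_image (c := c) oA.
split=> [Sf j c ac k|Sf c ac k]; first exact: (Ck_rowP k (f \o cinv c) (oc c)).1 (Sf c ac k) j.
by apply/Ck_rowP => // j; exact: Sf.
Qed.

Lemma smooth_map_chart c A (V : set 'rV[R]_n) (g : 'rV[R]_n -> R) :
  atlas c -> open A -> open V -> A `<=` cdom c ->
  (forall p, A p -> V (cmap c p)) -> smooth_on V g ->
  smooth_map_on A (g \o cmap c).
Proof.
move=> ac oA oV Ac AV Sg c' ac' k.
apply: (@Ck_comp _ _ _ k _ V (cmap c \o cinv c') g) => //; first exact: open_cmap_image.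
  by move=> _ [p [cp Ap] <-] /=; rewrite cmapK//; exact: AV.
apply: Ck_sub (transition_smooth ac' ac k) => _ [p [cp Ap] <-].
by exists p => //; split => //; exact: Ac.
Qed.

Lemma smooth_map_continuous A (f : N -> R) p :
  A p -> smooth_map_on A f -> {for p, continuous f}.
Proof.
move=> Ap Sf; set c := chart_at p; have cp : cdom c p := chart_at_dom p.
have Cf := Sf c (chart_at_atlas p) 0%N (cmap c p) (ex_intro2 _ _ p (conj cp Ap) erefl).
have Cg : {for p, continuous ((f \o cinv c) \o cmap c)}.
  by apply: continuous_comp Cf; exact: cmap_continuous.
rewrite /prop_for /continuous_at; have -> : f p = ((f \o cinv c) \o cmap c) p by rewrite /= cmapK.
apply: cvg_trans Cg; apply: near_eq_cvg.
apply: (@filterS _ (nbhs p) _ (cdom c)).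
  by move=> q cq /=; rewrite cmapK.
exact: open_nbhs_nbhs (conj (@cdom_open _ _ _ c) cp).
Qed.

(** The closed set [K] is part of the conclusion so that [O] and its complement form an open cover
    on which products with [chi] can be glued. *)
Lemma cutoff (p0 : N) O : open O -> O p0 ->
  exists (chi : N -> R) (K : set N), [/\ smooth_fun chi, \forall p \near p0, chi p = 1,
    closed K, K `<=` O & forall p, ~ K p -> chi p = 0].
Proof.
move=> oO Op; set c := chart_at p0; have cp : cdom c p0 := chart_at_dom p0.
have ac : atlas c := chart_at_atlas p0.
set x0 := cmap c p0.
have [r r0 rO] : exists2 r : R, 0 < r & forall x, `|x - x0| <= r -> (cmap c @` (cdom c `&` O)) x.
  have /nbhs_ballP [e e0 He] : nbhs x0 (cmap c @` (cdom c `&` O)).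
    by apply: open_nbhs_nbhs; split; [exact: open_cmap_image|exists p0].
  exists (e / 2); first by rewrite divr_gt0.
  move=> x xr; apply: He; rewrite -ball_normE /= distrC (le_lt_trans xr)//.
  by rewrite gtr_pMr// invf_lt1// ltr1n.
have [chi0 [Sc c1 c0]] := smooth_bump x0 r0.
pose D := [set x : 'rV[R]_n | `|x - x0| <= r].
pose K := cinv c @` D.
have Dc x : D x -> exists2 p, (cdom c `&` O) p & cmap c p = x by exact: rO.
(* [K] is the continuous image of a closed ball, hence compact, hence closed in the Hausdorff space
   [N] and not merely in the chart domain. *)
have cK : compact K.
  apply: continuous_compact.
    apply: continuous_in_subspaceT => x /set_mem /Dc [p [cp' _] <-].
    by apply: cinv_continuous; exists p.
  apply: bounded_closed_compact.
    exists (`|x0| + r); split; first exact: num_real.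
    move=> M /ltW HM x /= Dx; apply: le_trans HM.
    rewrite -(subrK x0 x) (le_trans (ler_normD _ _))// addrC lerD2l//.
  have -> : D = closed_ball_ Num.norm x0 r.
    by apply/seteqP; split => x; rewrite /D /closed_ball_ /= distrC.
  exact: closed_closed_ball_.
have clK : closed K by apply: compact_closed => //; exact: manifold_hausdorff.
pose chi p := if `[< cdom c p >] then chi0 (cmap c p) else 0.
have chi_cE p : cdom c p -> chi p = chi0 (cmap c p).
  by move=> cp'; rewrite /chi asboolT.
have chi_K p : ~ K p -> chi p = 0.
  move=> nK; rewrite /chi; case: asboolP => // cp'; apply: c0.
  rewrite leNgt; apply/negP => /ltW lr; apply: nK; exists (cmap c p) => //.
  exact: cmapK.
exists chi, K; split => //.
(* On the chart domain [chi] is a bump function in coordinates; on the open complement of [K] it is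
   zero. *)
- apply: (@smooth_map_sub _ (\bigcup_(b : bool) if b then cdom c else ~` K)).
    move=> p _; have [Kp|nKp] := pselect (K p); last by exists false.
    by exists true => //; case: Kp => x /Dc [q [cq _] <-] <-; rewrite cmapK.
  apply: smooth_map_bigcup => -[].
    have : smooth_map_on (cdom c) (chi0 \o cmap c).
      by apply: (@smooth_map_chart c _ setT) => //; [exact: cdom_open|exact: openT].
    by apply: smooth_map_ext => [|p cp' /=]; [exact: cdom_open|rewrite chi_cE].
  apply: (@smooth_map_ext _ _ (fun=> 0)); first exact: closed_openC.
    by move=> p /chi_K ->.
  exact: smooth_map_cst.
- have H1 : \forall p \near p0, chi0 (cmap c p) = 1.
    exact: cmap_continuous cp _ c1.
  apply: filterS2 H1 (open_nbhs_nbhs (conj (@cdom_open _ _ _ c) cp)) => p h1 h2.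
  by rewrite chi_cE.
- by move=> _ [x /Dc [q [cq Oq] <-] <-]; rewrite cmapK.
Qed.

Lemma smooth_cutoff A O K (chi f : N -> R) : open A -> open O -> closed K -> K `<=` O ->
  smooth_fun chi -> (forall p, ~ K p -> chi p = 0) ->
  smooth_map_on (A `&` O) f -> smooth_map_on A (fun p => chi p * f p).
Proof.
move=> oA oO cK KO Sc c0 Sf.
apply: (@smooth_map_sub _ (\bigcup_(b : bool) if b then A `&` O else A `&` ~` K)).
  move=> p Ap; have [Kp|nKp] := pselect (K p); last by exists false.
  by exists true => //; split => //; exact: KO.
apply: smooth_map_bigcup => -[].
  by apply: smooth_map_mul => //; [exact: openI|exact: smooth_map_sub Sc].
apply: (@smooth_map_ext _ _ (fun=> 0)); last exact: smooth_map_cst.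
  by apply: openI => //; exact: closed_openC.
by move=> p [_ /c0 ->]; rewrite mul0r.
Qed.

End SmoothMaps.

(** * Sections, the tangent bundle and the Lie bracket *)

Section Sections.
Context {R : realType} {n : nat} {N : manifold R n} {k : nat} {B : bundle_data N k}.
Hypothesis vB : is_vector_bundle B.

Lemma trivD (i : triv_index B) p (x y : B p) : base i p ->
  triv i (x + y) = triv i x + triv i y.
Proof. by move=> bp; have := triv_linear vB bp 1 x y; rewrite !scale1r. Qed.

Lemma trivZ (i : triv_index B) p (a : R) (x : B p) : base i p ->
  triv i (a *: x) = a *: triv i x.
Proof.
move=> bp; have L := triv_linear vB bp.
pose Lm := GRing.isLinear.Build _ _ _ _ _ L.
pose LL : {linear B p -> 'rV[R]_k} := HB.pack (triv i (p := p)) Lm.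
exact: (linearZ_LR LL a x).
Qed.

Lemma smooth_sectionD (s t : section B) :
  smooth_section s -> smooth_section t -> smooth_section (fun p => s p + t p).
Proof.
move=> Ss St i; have oi := base_open vB i.
have := smooth_map_add oi (Ss i) (St i); apply: smooth_map_ext => // p bp.
by rewrite trivD.
Qed.

Lemma smooth_sectionZ (f : N -> R) (s : section B) :
  smooth_fun f -> smooth_section s -> smooth_section (fun p => f p *: s p).
Proof.
move=> Sf Ss i; have oi := base_open vB i.
apply/smooth_map_rowP => // j.
have Sj := (smooth_map_rowP _ oi).1 (Ss i) j.
have := smooth_map_mul oi (smooth_map_sub (@subsetT _ (base i)) Sf) Sj.
apply: smooth_map_ext => // p bp.
by rewrite trivZ// mxE.
Qed.

Lemma smooth_oneformD (t u : oneform B) :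
  smooth_oneform t -> smooth_oneform u -> smooth_oneform (fun p v => t p v + u p v).
Proof.
move=> [Lt St] [Lu Su]; split.
  by move=> p a v w; rewrite Lt Lu mulrDr addrACA.
by move=> i w; apply: smooth_map_add => //; exact: base_open.
Qed.

Lemma smooth_oneformZ (f : N -> R) (t : oneform B) :
  smooth_fun f -> smooth_oneform t -> smooth_oneform (fun p v => f p * t p v).
Proof.
move=> Sf [Lt St]; split.
  by move=> p a v w; rewrite Lt mulrDr mulrCA.
move=> i w; apply: smooth_map_mul => //; first exact: base_open.
exact: smooth_map_sub Sf.
Qed.

Lemma smooth_pairing (t : oneform B) (s : section B) :
  smooth_oneform t -> smooth_section s -> smooth_fun (fun p => t p (s p)).
Proof.
move=> [Lt St] Ss.
apply: (@smooth_map_sub _ _ _ _ (\bigcup_i (base (b := B) i))).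
  by move=> p _; have [i bi] := base_cover vB p; exists i.
apply: smooth_map_bigcup => i; have oi := base_open vB i.
have Sj j : smooth_map_on (base i) (fun p => triv i (s p) 0 j * t p (untriv i p (delta_mx 0 j))).
  by apply: smooth_map_mul => //; exact: (smooth_map_rowP _ oi).1.
have := smooth_map_sum (index_enum 'I_k) oi Sj.
apply: smooth_map_ext => // p bp.
pose Lm := GRing.isLinear.Build _ _ _ _ _ (Lt p).
pose T : {linear B p -> R^o} := HB.pack (t p) Lm.
have Lu : linear (untriv (b := B) i p).
  move=> a v w; apply: (can_inj (trivK vB bp)).
  by rewrite (triv_linear vB bp) !(untrivK vB bp).
pose Um := GRing.isLinear.Build _ _ _ _ _ Lu.
pose U : {linear 'rV[R]_k -> B p} := HB.pack (untriv (b := B) i p) Um.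
rewrite -{2}(trivK vB bp (s p)) {2}(row_sum_delta (triv i (s p))).
rewrite -[RHS]/(T (U _)) !linear_sum; apply: eq_bigr => j _.
by rewrite !linearZ.
Qed.

End Sections.

(** * The tangent bundle: cocycle rule for coordinate changes and extension of tangent vectors *)

Section TangentBundle.
Context {R : realType} {n : nat} {N : manifold R n}.
Implicit Types (c : chart R n N) (p : N).

Lemma transition_diff c c' p : atlas c -> atlas c' -> cdom c p -> cdom c' p ->
  differentiable (cmap c' \o cinv c) (cmap c p).
Proof.
move=> ac ac' cp cp'; have [+ _] := transition_smooth ac ac' 1%N.
by apply; exists p.
Qed.

Lemma diff_transition_id c p (v : 'rV[R]_n) : cdom c p ->
  'd (cmap c \o cinv c) (cmap c p) v = v.
Proof.
move=> cp; have H : \forall x \near cmap c p, id x = (cmap c \o cinv c) x.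
  apply: filterS (open_nbhs_nbhs (conj (@cimg_open _ _ _ c) (ex_intro2 _ _ p cp erefl))).
  by move=> _ [q cq <-] /=; rewrite cmapK.
have did : differentiable (@id 'rV[R]_n) (cmap c p) by [].
have [_ ->] := near_eq_diff H did.
by rewrite diff_val.
Qed.

Lemma diff_transition_comp c1 c2 c3 p (v : 'rV[R]_n) :
  atlas c1 -> atlas c2 -> atlas c3 -> cdom c1 p -> cdom c2 p -> cdom c3 p ->
  'd (cmap c3 \o cinv c2) (cmap c2 p) ('d (cmap c2 \o cinv c1) (cmap c1 p) v) =
  'd (cmap c3 \o cinv c1) (cmap c1 p) v.
Proof.
move=> a1 a2 a3 p1 p2 p3.
have d12 := transition_diff a1 a2 p1 p2; have d23 := transition_diff a2 a3 p2 p3.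
have E : (cmap c2 \o cinv c1) (cmap c1 p) = cmap c2 p by rewrite /= cmapK.
rewrite -E in d23.
have H : \forall x \near cmap c1 p,
    ((cmap c3 \o cinv c2) \o (cmap c2 \o cinv c1)) x = (cmap c3 \o cinv c1) x.
  have o12 : open (cmap c1 @` (cdom c1 `&` cdom c2)).
    exact/open_cmap_image/cdom_open.
  apply: filterS (open_nbhs_nbhs (conj o12 (ex_intro2 _ _ p (conj p1 p2) erefl))).
  by move=> _ [q [q1 q2] <-] /=; rewrite !cmapK.
have dc := differentiable_comp d12 d23.
have [_ e] := near_eq_diff H dc.
have e1 := congr1 (fun F => F v) e.
have e2 := congr1 (fun F => F v) (diff_comp d12 d23).
rewrite -E; exact: esym (etrans e1 e2).
Qed.

Lemma tangent_vector_bundle : is_vector_bundle (tangent_bundle N).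
Proof.
have aP p := chart_at_atlas p; have dP (p : N) := chart_at_dom p.
split => /=.
- by case=> c /= ac; exact: cdom_open.
- by move=> p; exists (exist _ (chart_at p) (aP p)); exact: dP.
- by move=> [c ac] p cp a u v; exact: linearP.
- move=> [c ac] p /= cp v.
  rewrite /to_coord /of_coord (diff_transition_comp _ (aP p) ac (aP p))//.
  exact: diff_transition_id.
- move=> [c ac] p /= cp v.
  rewrite /to_coord /of_coord (diff_transition_comp _ ac (aP p) ac)//.
  exact: diff_transition_id.
- move=> [c ac] [c' ac'] w /=.
  have oI : open (cdom c `&` cdom c') by apply: openI; exact: cdom_open.
  apply/smooth_map_rowP => // j.
  (* By the cocycle rule, passing through the preferred chart at [p] amounts to the differential of
     the change from [c] to [c']. Its C^k regularity is the C^(k+1) regularity of that change. *)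
  pose g (x : 'rV[R]_n) : R := ('D_w (cmap c' \o cinv c) x) 0 j.
  have oV := open_cmap_image (c := c) (@cdom_open _ _ _ c').
  have Sg : smooth_on (cmap c @` (cdom c `&` cdom c')) g.
    move=> k; have [_ Hw] := transition_smooth ac ac' k.+1.
    exact: (Ck_rowP k _ oV).1 (Hw w) j.
  have := smooth_map_chart ac oI oV (@subIsetl _ _ _) _ Sg.
  have H : forall p, (cdom c `&` cdom c') p -> (cmap c @` (cdom c `&` cdom c')) (cmap c p).
    by move=> p cp; exists p.
  move=> /(_ H); apply: smooth_map_ext => // p [cp cp'] /=.
  rewrite /g /to_coord /of_coord (diff_transition_comp _ ac (aP p) ac')//.
  by rewrite deriveE//; exact: transition_diff.
Qed.

(** The field with constant components in the chart at [p], multiplied by a cutoff function, extends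
    by zero. *)
Lemma exists_smooth_vfield p (v : tangent p) :
  exists V : vfield N, smooth_vfield V /\ V p = v.
Proof.
set c := chart_at p; have ac : atlas c := chart_at_atlas p.
have cp : cdom c p := chart_at_dom p; have oc := @cdom_open _ _ _ c.
have [chi [K [Sc c1 cK Kc c0]]] := cutoff oc cp.
pose i0 : triv_index (tangent_bundle N) := exist _ c ac.
have TB := tangent_vector_bundle.
exists (fun q => chi q *: (untriv i0 q (to_coord c v) : tangent_bundle N q)); split; last first.
  rewrite (nbhs_singleton c1) scale1r; exact: (trivK TB (i := i0) cp).
move=> i; have oi := base_open TB i; apply/smooth_map_rowP => // j.
have Sj : smooth_map_on (base i `&` cdom c)
    (fun q => triv i (untriv i0 q (to_coord c v)) 0 j).
  move: j; apply/smooth_map_rowP; first exact: openI.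
  by rewrite setIC; exact: (triv_smooth TB i0 i).
have := smooth_cutoff oi oc cK Kc Sc c0 Sj.
apply: smooth_map_ext => // q iq.
by rewrite (trivZ TB) ?mxE.
Qed.

End TangentBundle.

(** * Additivity and the Leibniz rule for the Lie bracket *)

Section LieBracket.
Context {R : realType} {n : nat} {N : manifold R n}.
Implicit Types (V W : vfield N) (p : N).
Local Notation TB := (tangent_vector_bundle (N := N)).

Lemma diff_coord m (F : 'rV[R]_n -> 'rV[R]_m) x v j : differentiable F x ->
  differentiable (fun y => F y 0 j : R) x /\ 'd F x v 0 j = 'd (fun y => F y 0 j : R) x v.
Proof.
move=> dF; have dj : differentiable (fun y => F y 0 j : R) x.
  exact: (differentiable_comp dF (differentiable_coord (F x) 0 j)).
split => //; rewrite -!deriveE// derive_mx; last exact: diff_derivable.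
by rewrite mxE.
Qed.

Lemma vector_bracketDl (A A' B : 'rV[R]_n -> 'rV[R]_n) x :
  differentiable A x -> differentiable A' x ->
  'd B x ((A + A') x) - 'd (A + A') x (B x) =
  ('d B x (A x) - 'd A x (B x)) + ('d B x (A' x) - 'd A' x (B x)).
Proof.
move=> dA dA'.
have e1 : 'd B x ((A + A') x) = 'd B x (A x) + 'd B x (A' x) by exact: linearD.
have e2 := congr1 (fun F => F (B x)) (diffD dA dA').
by apply: (etrans (congr2 (fun s t => s - t) e1 e2)); rewrite opprD addrACA.
Qed.

Lemma vector_bracketZl (u : 'rV[R]_n -> R) (A A' B : 'rV[R]_n -> 'rV[R]_n) x :
  differentiable u x -> differentiable A x -> differentiable A' x ->
  (forall y, A' y = u y *: A y) ->
  'd B x (A' x) - 'd A' x (B x) =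
  u x *: ('d B x (A x) - 'd A x (B x)) - 'd u x (B x) *: A x.
Proof.
move=> du dA dA' E.
have e1 : 'd B x (A' x) = u x *: 'd B x (A x) by rewrite E; exact: linearZ_LR.
have e2 : 'd A' x (B x) = u x *: 'd A x (B x) + 'd u x (B x) *: A x.
  apply/rowP => j; have [_ f1] := diff_coord (B x) j dA'.
  have [dj f2] := diff_coord (B x) j dA.
  have f3 : (fun y => A' y 0 j : R) = u * (fun y => A y 0 j).
    by apply/funext => y; rewrite E mxE.
  apply: (etrans f1); rewrite f3.
  apply: (etrans (congr1 (fun F => F (B x)) (diffM du dj))).
  rewrite !mxE; exact: (congr2 +%R (congr1 ( *%R (u x)) (esym f2)) (mulrC _ _)).
apply: (etrans (congr2 (fun s t => s - t) e1 e2)).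
by rewrite scalerBr opprD addrA.
Qed.

Lemma coord_vfield_diff V p : smooth_vfield V ->
  differentiable (coord_vfield (chart_at p) V) (cmap (chart_at p) p).
Proof.
move=> SV; have ac := chart_at_atlas p; have cp := chart_at_dom p.
have [H _] := SV (exist _ _ ac) _ ac 1%N.
exact: (H _ (ex_intro2 _ _ p (conj cp cp) erefl)).
Qed.

Lemma coord_vfield_id V p :
  coord_vfield (chart_at p) V (cmap (chart_at p) p) = V p.
Proof.
by rewrite /coord_vfield cmapK; [exact/diff_transition_id/chart_at_dom|exact: chart_at_dom].
Qed.

Lemma lie_bracketC V W p : lie_bracket V W p = - lie_bracket W V p.
Proof. by rewrite /lie_bracket opprB. Qed.

Lemma lie_bracketDl V V' W p : smooth_vfield V -> smooth_vfield V' ->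
  lie_bracket (fun q => V q + V' q) W p = lie_bracket V W p + lie_bracket V' W p.
Proof.
move=> SV SV'.
have E : coord_vfield (chart_at p) (fun q => V q + V' q) =
    coord_vfield (chart_at p) V + coord_vfield (chart_at p) V'.
  by apply/funext => x; exact: linearD.
apply: etrans (vector_bracketDl (coord_vfield (chart_at p) W)
  (coord_vfield_diff p SV) (coord_vfield_diff p SV')).
by rewrite -E.
Qed.

(** The coefficient [g] is the derivative of [f] along [W] at [p]. It may stay anonymous: the rule
    is applied with [V = Z], and [P] kills multiples of [Z]. *)
Lemma lie_bracketZl (f : N -> R) V W p :
  smooth_fun f -> smooth_vfield V -> exists g : R,
  lie_bracket (fun q => f q *: V q) W p = f p *: lie_bracket V W p - g *: V p.
Proof.
move=> Sf SV; have ac := chart_at_atlas p; have cp := chart_at_dom p.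
have du : differentiable (f \o cinv (chart_at p)) (cmap (chart_at p) p).
  have [H _] := Sf _ ac 1%N.
  exact: (H _ (ex_intro2 _ _ p (conj cp I) erefl)).
have SfV := smooth_sectionZ TB Sf SV.
have E := vector_bracketZl (coord_vfield (chart_at p) W) du
  (coord_vfield_diff p SV) (coord_vfield_diff p SfV)
  (fun y => linearZ_LR ('d _ _) _ _).
have fp : (f \o cinv (chart_at p)) (cmap (chart_at p) p) = f p by rewrite /= cmapK.
rewrite fp in E; eexists; apply: (etrans E); congr (_ - _ *: _).
exact: coord_vfield_id.
Qed.

End LieBracket.

(** * One-forms with tau(Z) = 1 *)

Section ExistsForm.
Context {R : realType} {n : nat} {N : manifold R n} {Z : vfield N}.
Hypotheses (SZ : smooth_vfield Z) (Z0 : forall p, Z p != 0).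
Local Notation TB := (tangent_vector_bundle (N := N)).

(** Some component [Z^j] of [Z] in a chart is nonzero at [p0]; the form is [dx^j / Z^j], cut off
    inside the set [O] where [Z^j] does not vanish. *)
Lemma exists_local_form (p0 : N) : exists theta : oneform (tangent_bundle N),
  smooth_oneform theta /\ \forall p \near p0, theta p (Z p) = 1.
Proof.
set c := chart_at p0; have ac : atlas c := chart_at_atlas p0.
have cp : cdom c p0 := chart_at_dom p0; have oc := @cdom_open _ _ _ c.
pose i0 : triv_index (tangent_bundle N) := exist _ c ac.
pose Zc p : 'rV[R]_n := triv i0 (Z p).
have [j Zj] : exists j, Zc p0 0 j != 0.
  apply/existsP; apply: contraT => /existsPn H.
  have Zc0 : Zc p0 = 0 by apply/rowP => j; rewrite mxE; apply/eqP; rewrite -[_ == _]negbK H.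
  have := Z0 p0; rewrite -(trivK TB (i := i0) cp (Z p0)) -/(Zc p0) Zc0.
  by rewrite /= /of_coord linear0 eqxx.
have SZj : smooth_map_on (cdom c) (fun p => Zc p 0 j) by exact: (smooth_map_rowP _ oc).1 (SZ i0) j.
pose O := cdom c `&` [set p | Zc p 0 j != 0].
have oO : open O.
  rewrite openE => p [cp' Zp].
  apply: filterI; first exact: open_nbhs_nbhs.
  have := smooth_map_continuous cp' SZj => /(_ [set t | t != 0]); apply.
  by apply: open_nbhs_nbhs; split => //; exact: open_neq.
have [chi [K [Sc c1 cK KO c0]]] := cutoff oO (conj cp Zj).
exists (fun p v => chi p * ((triv i0 v : 'rV[R]_n) 0 j * (Zc p 0 j)^-1)); split; last first.
  apply: filterS2 c1 (open_nbhs_nbhs (conj oO (conj cp Zj))) => p -> [_ Zp].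
  by rewrite mul1r mulfV.
split.
  move=> p a v w.
  have L : linear (to_coord c (p := p)) by move=> b x y; exact: linearP.
  have -> : triv i0 (a *: v + w) = a *: (triv i0 v : 'rV[R]_n) + triv i0 w by exact: L.
  rewrite !mxE mulrDl mulrDr; congr (_ + _).
  by rewrite mulrCA -!mulrA; congr (_ * _); rewrite mulrCA.
move=> i w; have oi := base_open TB i.
apply: (smooth_cutoff oi oO cK KO Sc c0).
have oiO : open (base i `&` O) by exact: openI.
have oic : open (base i `&` cdom c) by exact: openI.
have St := (smooth_map_rowP _ oic).1 (triv_smooth TB i i0 w) j.
apply: smooth_map_mul => //.
  by apply: smooth_map_sub St => p [? []].
apply: smooth_map_inv => //; first by move=> p [_ []].
by apply: smooth_map_sub SZj => p [_ []].
Qed.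

(** Index by the codes of a countable basis, keeping the basis sets that carry a form with value 1
    on [Z]. By the local construction every point lies in such a set. *)
Lemma exists_countable_forms :
  exists (theta : nat -> oneform (tangent_bundle N)) (O : nat -> set N),
  [/\ forall k, smooth_oneform (theta k), forall k, open (O k),
      forall k p, O k p -> theta k p (Z p) = 1 & forall p, exists k, O k p].
Proof.
have [Bs /countable_injP [code inj_code] [Bo Bb]] := @manifold_second_countable _ _ N.
pose good (U : set N) (theta : oneform (tangent_bundle N)) :=
  [/\ smooth_oneform theta, open U & forall p, U p -> theta p (Z p) = 1].
have zero_smooth : smooth_oneform (fun p (v : tangent_bundle N p) => 0 : R).
  split; first by move=> p a v w; rewrite mulr0 addr0.
  by move=> i w; exact: smooth_map_cst.
have /choice [F HF] : forall k, exists Ut : set N * oneform (tangent_bundle N),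
    good Ut.1 Ut.2 /\
    forall U theta, Bs U -> code U = k -> good U theta -> Ut.1 = U.
  move=> k; have [[U [BU cU [theta g]]]|no] := pselect (exists U, [/\ Bs U, code U = k &
      exists theta, good U theta]).
    exists (U, theta); split => // U' theta' BU' cU' _ /=.
    by apply: inj_code; rewrite ?inE// cU cU'.
  (* A code without a suitable basis set gets the empty set, on which the zero form qualifies
     vacuously. *)
  exists (set0, fun p v => 0); split; first by split => //=; exact: open0.
  by move=> U theta BU cU g; case: no; exists U; split => //; exists theta.
exists (fun k => (F k).2), (fun k => (F k).1); split.
- by move=> k; case: (HF k) => -[].
- by move=> k; case: (HF k) => -[].
- by move=> k; case: (HF k) => -[].
move=> p; have [theta [St t1]] := exists_local_form p.
have [U [BU Up] Ut] := Bb p [set q | theta q (Z q) = 1] t1.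
exists (code U); have [_ H] := HF (code U).
rewrite (H U theta)//; split => //; exact: Bo.
Qed.

(* The summand a k * theta k, where a k = prod_(i < k) (1 - theta i (Z)),
   vanishes on O j for j < k: the sum is finite near each point although the
   cover need not be locally finite. *)
Lemma exists_Sforms : exists tau, Sforms Z tau.
Proof.
have [theta [ O [St oO t1 cov]]] := exists_countable_forms.
pose f k p := theta k p (Z p).
have Sf k : smooth_fun (f k) := smooth_pairing TB (St k) SZ.
pose a := fix a k p : R := if k is k'.+1 then a k' p * (1 + -1 * f k' p) else 1.
have Sa k : smooth_fun (a k).
  elim: k => [|k IH]; first exact: (@smooth_map_cst _ _ _ _ setT (1 : R)).
  have Sc (b : R) : @smooth_fun _ _ N (fun=> b) by exact: (@smooth_map_cst _ _ _ _ setT b).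
  have Saf := smooth_map_mul openT (Sc (-1)) (Sf k).
  exact (smooth_map_mul openT IH (smooth_map_add openT (Sc 1) Saf)).
pose t := fix t k : oneform (tangent_bundle N) :=
  if k is k'.+1 then fun p v => t k' p v + a k' p * theta k' p v else fun p v => 0.
have S_t k : smooth_oneform (t k).
  elim: k => [|k IH] /=.
    split; first by move=> p b v w; rewrite mulr0 addr0.
    by move=> i w; exact: smooth_map_cst.
  exact (smooth_oneformD TB IH (smooth_oneformZ TB (Sa k) (St k))).
(* Telescoping: each summand contributes [a k * f k], which is [a k - a k.+1]. *)
have tZ k p : t k p (Z p) = 1 - a k p.
  elim: k => [|k IH] /=; first by rewrite subrr.
  by rewrite IH -/(f k p); ring.
have a0 j k p : O j p -> (j < k)%N -> a k p = 0.
  move=> Op; elim: k => // k IH; rewrite ltnS leq_eqVlt => /orP[/eqP <-|/IH /= ->].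
    by rewrite /= /f t1// mulN1r subrr mulr0.
  by rewrite mul0r.
have t_stable j k p v : O j p -> (j < k)%N -> t k p v = t j.+1 p v.
  move=> Op; elim: k => // k IH; rewrite ltnS leq_eqVlt => /orP[/eqP <- //|jk].
  by rewrite /= (a0 j)// mul0r addr0 IH.
have /choice [K HK] := cov.
(* The choice of [K p] need not vary continuously, but the value does not depend on it: on all of
   [O j] the form equals the fixed partial sum [t j.+1]. *)
pose tau : oneform (tangent_bundle N) := fun p v => t (K p).+1 p v.
have tauE j p v : O j p -> tau p v = t j.+1 p v.
  move=> Op; have [jK|Kj] := leqP j (K p); first by rewrite /tau (t_stable j).
  by rewrite [RHS](t_stable (K p))// ltnS ltnW.
exists tau; split; last by move=> p; rewrite /tau tZ (a0 (K p))// subr0.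
split; first by move=> p; case: (S_t (K p).+1) => + _; exact.
move=> i w; have oi := base_open TB i.
apply: (@smooth_map_sub _ _ _ _ (\bigcup_j (base i `&` O j))).
  by move=> p ip; exists (K p).
apply: smooth_map_bigcup => j.
have [_ /(_ i w) H] := S_t j.+1.
apply: (smooth_map_ext (openI oi (oO j))) (smooth_map_sub (@subIsetl _ _ _) H).
by move=> p [_ Op]; rewrite (tauE j).
Qed.

End ExistsForm.

(** * Lightlike extension bundles *)

Section ScalarMaps.
Context {R : realType} {V : lmodType R} {f : V -> R}.
Hypothesis Lf : scalar f.

Lemma functional0 : f 0 = 0.
Proof. by have := Lf (-1) 0 0; rewrite scaler0 add0r mulN1r addNr. Qed.

Lemma functionalD x y : f (x + y) = f x + f y.
Proof. by have := Lf 1 x y; rewrite scale1r mul1r. Qed.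

Lemma functionalZ a x : f (a *: x) = a * f x.
Proof. by have := Lf a x 0; rewrite !addr0 functional0 addr0. Qed.

Lemma functionalB x y : f (x - y) = f x - f y.
Proof. by rewrite -scaleN1r functionalD functionalZ mulN1r. Qed.

Lemma functional_sum (I : Type) (r : seq I) (F : I -> V) :
  f (\sum_(i <- r) F i) = \sum_(i <- r) f (F i).
Proof. exact: (big_morph f functionalD functional0). Qed.

End ScalarMaps.

Section LinearMaps.
Context {R : realType} {U V : lmodType R} {f : U -> V}.
Hypothesis Lf : linear f.

Lemma linmap0 : f 0 = 0.
Proof. by have := Lf (-1) 0 0; rewrite scaler0 add0r scaleN1r addNr. Qed.

Lemma linmapD x y : f (x + y) = f x + f y.
Proof. by have := Lf 1 x y; rewrite !scale1r. Qed.

Lemma linmapZ a x : f (a *: x) = a *: f x.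
Proof. by have := Lf a x 0; rewrite !addr0 linmap0 addr0. Qed.

Lemma linmapB x y : f (x - y) = f x - f y.
Proof. by rewrite -scaleN1r linmapD linmapZ scaleN1r. Qed.

End LinearMaps.

(** * The projection to An(tau), and definiteness of [h] there *)

Section Forms.
Context {R : realType} {n : nat} {N : manifold R n}.
Context {h : twoform (tangent_bundle N)} {Z : vfield N} {tau : oneform (tangent_bundle N)}.
Arguments tau : clear implicits.
Hypotheses (hN : is_lightlike_manifold h Z) (hS : Sforms Z tau).
Local Notation TN := (tangent_bundle N).
Local Notation TB := (tangent_vector_bundle (N := N)).

Lemma Sforms_scalar p : scalar (tau p).
Proof. by case: hS => -[+ _] _; exact. Qed.

Lemma Sforms_Z p : tau p (Z p) = 1.
Proof. by case: hS => _; exact. Qed.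

Lemma Anfield_Pproj V : smooth_vfield V -> Anfield tau (Pproj Z tau V).
Proof.
case: hN => _ SZ _ _ _; case: hS => Stau tauZ SV; split; last first.
  move=> p; have tS := @Sforms_scalar p.
  rewrite /Pproj (functionalB tS) (functionalZ tS) Sforms_Z.
  by rewrite mulr1 subrr.
have Sc : @smooth_fun _ _ N (fun=> -1) by exact: (@smooth_map_cst _ _ _ _ setT (-1 : R)).
have Sf : smooth_fun (fun p => -1 * tau p (V p)).
  exact (smooth_map_mul openT Sc (smooth_pairing TB Stau SV)).
have := smooth_sectionD TB SV (smooth_sectionZ TB Sf SZ).
congr smooth_section; apply/funext => p.
by rewrite /Pproj mulN1r scaleNr.
Qed.

(** A null vector of a semidefinite form lies in its radical, here the line of [Z], and [tau]
    vanishes on that line only at 0. *)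
Lemma lightlike_definite p (v : TN p) : h v v = 0 -> tau p v = 0 -> v = 0.
Proof.
case: hN => -[Sc Cc _] _ Pos _ Rad hv tv.
have hvw w : h v w = 0.
  apply/eqP; apply: contraT => c0.
  have hD (x y : TN p) : h x y = h y x by exact: Cc.
  (* With this [s] the vector [s *: v + w] would have square [2 * s * c + h w w = -1]. *)
  pose c := h v w; pose s := - (h w w + 1) / (2 * c).
  have := Pos p (s *: v + w).
  rewrite (Sc p) !(hD (s *: v + w)) !(Sc p) hv (hD w v) -/c mulr0 add0r.
  have -> : s * c + (s * c + h w w) = -1 by rewrite /s; field.
  by rewrite oppr_ge0 ler10.
have /Rad [a va] := hvw.
by move: tv; rewrite va (functionalZ (@Sforms_scalar p)) Sforms_Z mulr1 => ->; rewrite scale0r.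
Qed.

End Forms.

(** * Linear algebra in the fibers of an extension bundle *)

Section ExtensionAlgebra.
Context {R : realType} {n : nat} {N : manifold R n} {E : extension_data N}.
Context {h : twoform (tangent_bundle N)} {Z : vfield N}.
Hypotheses (hE : is_lightlike_extension E) (hh : extends E h Z).
Local Notation TN := (tangent_bundle N).
Local Notation T := (ext_bundle E).
Local Notation H := (@ext_metric _ _ _ E _).
Local Notation Phi := (@Defs.Phi _ _ _ E _).
Local Notation D := (@ext_conn _ _ _ E).
Local Notation xi := (@ext_xi _ _ _ E).

Lemma ext_metricC p (x y : T p) : H x y = H y x.
Proof. by have [[_ + _] _] := ext_lorentzian hE; exact. Qed.

Lemma ext_metric_scalar p (x : T p) : scalar (H x).
Proof. by have [[+ _ _] _] := ext_lorentzian hE; exact. Qed.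

Lemma ext_metric_nondeg p (x : T p) : (forall y, H x y = 0) -> x = 0.
Proof.
move=> Hx; have [_ /(_ p) [e [span orth]]] := ext_lorentzian hE.
have [a xa] := span x; rewrite xa big1// => j _.
have := Hx (e j); rewrite ext_metricC xa (functional_sum (ext_metric_scalar _)).
rewrite (bigD1 j)//= big1 ?addr0; last first.
  move=> i ij; rewrite (functionalZ (ext_metric_scalar _)) orth.
  by rewrite eq_sym (negbTE ij) mulr0.
rewrite (functionalZ (ext_metric_scalar _)) orth eqxx => /eqP.
by rewrite mulf_eq0; case: ifP => _; rewrite ?oppr_eq0 oner_eq0 orbF => /eqP ->; rewrite scale0r.
Qed.

Lemma Phi_linear p : linear (@Defs.Phi _ _ _ E p).
Proof. exact: (connection_linear (ext_connection hE) (ext_xi_smooth hE)). Qed.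

Lemma Phi0 p : Phi (0 : TN p) = 0.
Proof. exact: linmap0 (Phi_linear (p := p)). Qed.

Lemma PhiB p (v w : TN p) : Phi (v - w) = Phi v - Phi w.
Proof. exact: linmapB (Phi_linear (p := p)) _ _. Qed.

Lemma PhiZ p a (v : TN p) : Phi (a *: v) = a *: Phi v.
Proof. exact: linmapZ (Phi_linear (p := p)) _ _. Qed.

Lemma Phi_Z p : Phi (Z p) = xi p.
Proof. by case: hh. Qed.

Lemma dfun_cst (a : R) p (v : TN p) : dfun (fun=> a) v = 0.
Proof.
have e := @diff_cst R _ _ a (cmap (chart_at p) p).
exact: (congr1 (fun F : 'rV[R]_n -> R => F v) e).
Qed.

Lemma xi_null p : H (xi p) (xi p) = 0.
Proof. by case: (ext_xi_lightlike hE p). Qed.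

(** Differentiate [H(xi, xi) = 0] with the metric connection. *)
Lemma metric_xi_Phi p (v : TN p) : H (xi p) (Phi v) = 0.
Proof.
have Sxi := ext_xi_smooth hE.
have := ext_metric_connection hE v Sxi Sxi.
have -> : (fun q => H (xi q) (xi q)) = fun=> 0 by apply/funext => q; exact: xi_null.
rewrite dfun_cst [X in _ = X + _]ext_metricC -mulr2n => /esym/eqP.
by rewrite mulrn_eq0 => /eqP.
Qed.

Section Splitting.
Context {tau : oneform TN}.
Arguments tau : clear implicits.
Hypothesis hS : Sforms Z tau.
Local Notation eta := (eta E tau).

Let tauL p : scalar (tau p) := @Sforms_scalar _ _ _ _ _ hS p.
Let tauZ p : tau p (Z p) = 1 := Sforms_Z hS p.

(** The map sending [u] to [H (Phi _) u] is the transpose of the map [v] to [H (Phi v)]. The latter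
    is injective since [Phi] is and [H] is nondegenerate, so the former is onto. In matrices,
    [lin1_mx f] has free rows, hence a right inverse [B']. *)
Lemma exists_represents p : exists u : T p, forall v : TN p, H (Phi v) u = tau p v.
Proof.
have [i bi] := base_cover (ext_vector_bundle hE) p.
have vB := ext_vector_bundle hE.
pose ub b : T p := untriv (b := T) i p (delta_mx 0 b).
have untriv_sum (w : 'rV[R]_n.+1) : untriv (b := T) i p w = \sum_b w 0 b *: ub b.
  apply: (can_inj (trivK vB bi)); rewrite (untrivK vB bi).
  rewrite (big_morph _ (fun x y => trivD vB x y bi) (_ : _ = 0)); last first.
    by have := trivZ vB 0 (0 : T p) bi; rewrite !scale0r.
  rewrite [LHS]row_sum_delta; apply: eq_bigr => b _.
  by rewrite (trivZ vB)// (untrivK vB bi).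
pose f (x : 'rV[R]_n) : 'rV[R]_n.+1 := \row_b H (Phi (x : TN p)) (ub b).
have Lf : linear f.
  move=> a x y; apply/rowP => b; rewrite !mxE ext_metricC Phi_linear.
  by rewrite ext_metric_scalar !(ext_metricC (ub b)).
pose Lm := GRing.isLinear.Build _ _ _ _ _ Lf.
pose LL : {linear 'rV[R]_n -> 'rV[R]_n.+1} := HB.pack f Lm.
have fE x : x *m lin1_mx f = f x by exact: (mul_rV_lin1 LL).
have /row_freeP [B' BB'] : row_free (lin1_mx f).
  apply: inj_row_free => x; rewrite fE => fx0.
  have : Phi (x : TN p) = 0.
    apply: ext_metric_nondeg => y; rewrite -(trivK vB bi y) untriv_sum.
    rewrite (functional_sum (ext_metric_scalar _)) big1// => b _.
    rewrite (functionalZ (ext_metric_scalar _)).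
    by move/rowP: fx0 => /(_ b); rewrite !mxE => ->; rewrite mulr0.
  by rewrite -[RHS](Phi0 p) => /(ext_mono hE).
pose u := B' *m \col_a tau p (delta_mx 0 a : 'rV[R]_n).
exists (untriv (b := T) i p u^T) => v.
rewrite untriv_sum (functional_sum (ext_metric_scalar _)).
transitivity (((v : 'rV[R]_n) *m lin1_mx f *m u) 0 0).
  rewrite fE mxE; apply: eq_bigr => b _.
  by rewrite (functionalZ (ext_metric_scalar _)) !mxE mulrC.
rewrite mulmxA -(mulmxA (v : 'rV[R]_n)) BB' mulmx1 mxE.
rewrite {2}(row_sum_delta (v : 'rV[R]_n)) (functional_sum (@tauL p)).
by apply: eq_bigr => a _; rewrite mxE (functionalZ (@tauL p)).
Qed.

(** The last clause covers all tangent vectors: on An(tau) both sides vanish, on [Z] both are 1. *)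
Lemma eta_spec p : [/\ H (eta p) (eta p) = 0, H (xi p) (eta p) = 1 &
  forall v : TN p, H (Phi v) (eta p) = tau p v].
Proof.
suff [y [ynull yxi yPhi]] : exists y : T p, [/\ lightlike y, H (xi p) y = 1 &
    forall v : TN p, tau p v = 0 -> H (Phi v) y = 0].
  have : [set y : T p | [/\ lightlike y, H (xi p) y = 1 &
    forall v : TN p, tau p v = 0 -> H (Phi v) y = 0]] (eta p).
    by apply: xgetPex; exists y.
  move=> [[_ e0] e1 e2]; split => // v.
  have : tau p (v - tau p v *: Z p) = 0.
    by rewrite (functionalB (@tauL p)) (functionalZ (@tauL p)) tauZ mulr1 subrr.
  move/e2; rewrite PhiB PhiZ Phi_Z ext_metricC.
  rewrite (functionalB (ext_metric_scalar _)) (functionalZ (ext_metric_scalar _)).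
  by rewrite [H _ (xi p)]ext_metricC e1 mulr1 ext_metricC => /subr0_eq.
have [u Hu] := exists_represents p.
have xiu : H (xi p) u = 1 by rewrite -Phi_Z Hu.
(* Since [H(xi, u) = tau(Z) = 1], this multiple of [xi] makes [y] null; as [xi] is orthogonal to the
   image of [Phi], the pairings with that image do not change. *)
pose y := u - (H u u / 2) *: xi p.
have Hy x : H x y = H x u - (H u u / 2) * H x (xi p).
  by rewrite (functionalB (ext_metric_scalar _)) (functionalZ (ext_metric_scalar _)).
have xiy : H (xi p) y = 1 by rewrite Hy xi_null mulr0 subr0.
exists y; split => //.
  split.
    apply/eqP => y0; move/eqP: xiy; rewrite y0 (functional0 (ext_metric_scalar _)).
    by rewrite eq_sym oner_eq0.
  rewrite Hy ![H y _]ext_metricC xiy Hy [H u (xi p)]ext_metricC xiu; by field.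
by move=> v v0; rewrite Hy Hu v0 [H _ (xi p)]ext_metricC metric_xi_Phi mulr0 subr0.
Qed.

(** Pairing with [xi] isolates [b], pairing with [eta] isolates [a], and injectivity of [Phi] gives
    [x]. *)
Lemma splitting_unique p (x x' : TN p) (a b a' b' : R) :
  tau p x = 0 -> tau p x' = 0 ->
  a *: xi p + Phi x + b *: eta p = a' *: xi p + Phi x' + b' *: eta p ->
  [/\ a = a', x = x' & b = b'].
Proof.
move=> x0 x'0 e; have [ee xe Pe] := eta_spec p.
have ex : H (eta p) (xi p) = 1 by rewrite ext_metricC.
have eP v : H (eta p) (Phi v) = tau p v by rewrite ext_metricC.
have bb' : b = b'.
  have := congr1 (H (xi p)) e; rewrite !(functionalD (ext_metric_scalar _)).
  rewrite !(functionalZ (ext_metric_scalar _)) xi_null !metric_xi_Phi xe.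
  by rewrite !mulr0 !add0r !mulr1.
have aa' : a = a'.
  have := congr1 (H (eta p)) e; rewrite !(functionalD (ext_metric_scalar _)).
  rewrite !(functionalZ (ext_metric_scalar _)) ee ex !eP x0 x'0.
  by rewrite !mulr0 !addr0 !mulr1.
split => //; apply: (ext_mono hE).
by move: e; rewrite aa' bb' => /addIr/addrI.
Qed.

Lemma splitting_exists p (y : T p) : exists (x : TN p) (a b : R),
  tau p x = 0 /\ y = a *: xi p + Phi x + b *: eta p.
Proof.
suff [x [b ->]] : exists (x : TN p) (b : R), y = Phi x + b *: eta p.
  exists (x - tau p x *: Z p), (tau p x), b; split.
    by rewrite (functionalB (@tauL p)) (functionalZ (@tauL p)) tauZ mulr1 subrr.
  by rewrite PhiB PhiZ Phi_Z [_ *: _ + (_ - _)]addrC subrK.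
have [ee xe Pe] := eta_spec p.
have vB := ext_vector_bundle hE; have [i bi] := base_cover vB p.
pose f (x : 'rV[R]_n) : 'rV[R]_n.+1 := triv i (Phi (x : TN p)).
have Lf : linear f by move=> a x z; rewrite /f Phi_linear (triv_linear vB bi).
pose Lm := GRing.isLinear.Build _ _ _ _ _ Lf.
pose LL : {linear 'rV[R]_n -> 'rV[R]_n.+1} := HB.pack f Lm.
have fE x : x *m lin1_mx f = f x by exact: (mul_rV_lin1 LL).
(* The rows are the images of a basis under [Phi], followed by [eta]. They are independent, as
   pairing with [xi] detects the [eta] coefficient, and there are as many as the rank of the bundle,
   so they span. *)
pose M := col_mx (lin1_mx f) (triv i (eta p)).
have ME (u : 'rV[R]_(n + 1)) :
    u *m M = triv i (Phi (lsubmx u : TN p) + (rsubmx u) 0 0 *: eta p).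
  rewrite -{1}(hsubmxK u) mul_row_col fE (trivD vB)// (trivZ vB)//; congr (_ + _).
  by rewrite [X in X *m _]mx11_scalar mul_scalar_mx.
have : row_free M.
  apply: inj_row_free => u; rewrite ME => u0.
  have {}u0 : Phi (lsubmx u : TN p) + (rsubmx u) 0 0 *: eta p = 0.
    apply: (can_inj (trivK vB bi)); rewrite u0.
    by have := trivZ vB 0 (0 : T p) bi; rewrite !scale0r.
  have r0 : (rsubmx u) 0 0 = 0.
    have := congr1 (H (xi p)) u0; rewrite (functionalD (ext_metric_scalar _)).
    rewrite (functionalZ (ext_metric_scalar _)) metric_xi_Phi xe add0r mulr1.
    by rewrite (functional0 (ext_metric_scalar _)).
  move: u0; rewrite r0 scale0r addr0 -[RHS](Phi0 p) => /(ext_mono hE) l0.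
  by rewrite -(hsubmxK u) l0 (mx11_scalar (rsubmx u)) r0 raddf0 row_mx0.
rewrite /row_free => /eqP rM.
have fM : row_full M by rewrite /row_full rM addn1.
have /submxP [u yu] := submx_full (triv i y) fM.
exists (lsubmx u), ((rsubmx u) 0 0); apply: (can_inj (trivK vB bi)).
by rewrite yu ME.
Qed.

Local Notation An := (An_component (E := E) tau).

Lemma An_componentE p (x : TN p) (a b : R) : tau p x = 0 ->
  An (a *: xi p + Phi x + b *: eta p) = x.
Proof.
move=> x0; set y := (X in An X).
have [t0 [a' [b' e]]] : [set x : TN p | tau p x = 0 /\
    exists a b : R, y = a *: xi p + Phi x + b *: eta p] (An y).
  by apply: xgetPex; exists x; split => //; exists a, b.
by have [] := splitting_unique x0 t0 e.
Qed.

(** The explicit coefficient of [eta] reduces collinearity of [y] with [xi] to two conditions: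
    [An y = 0] and [H (xi p) y = 0]. *)
Lemma An_componentP p (y : T p) : tau p (An y) = 0 /\
  exists a, y = a *: xi p + Phi (An y) + H (xi p) y *: eta p.
Proof.
have [ee xe Pe] := eta_spec p.
have [x [a [b [x0 ->]]]] := splitting_exists y; rewrite An_componentE//; split => //.
exists a; rewrite !(functionalD (ext_metric_scalar _)) !(functionalZ (ext_metric_scalar _)).
by rewrite xi_null metric_xi_Phi xe mulr0 !add0r mulr1.
Qed.

Lemma An_component_linear p : linear (An_component (E := E) tau (p := p)).
Proof.
move=> c y z; have [x [a [b [x0 ->]]]] := splitting_exists y.
have [x' [a' [b' [x'0 ->]]]] := splitting_exists z.
rewrite !An_componentE//.
rewrite -[RHS](@An_componentE p _ (c * a + a') (c * b + b')); last first.
  by rewrite tauL x0 x'0 mulr0 addr0.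
congr (An _); rewrite Phi_linear !scalerDr !scalerDl !scalerA.
by rewrite [LHS]addrACA; congr (_ + _); exact: addrACA.
Qed.

Lemma An_component_Phi p (v : TN p) : An (Phi v) = v - tau p v *: Z p.
Proof.
rewrite -[RHS](@An_componentE p _ (tau p v) 0).
  by rewrite scale0r addr0 PhiB PhiZ Phi_Z addrC subrK.
by rewrite (functionalB (@tauL p)) (functionalZ (@tauL p)) tauZ mulr1 subrr.
Qed.

Lemma An_component_xi p (a : R) : An (a *: xi p) = 0.
Proof.
rewrite -[RHS](@An_componentE p 0 a 0); last exact: functional0 (@tauL p).
by rewrite Phi0 addr0 scale0r addr0.
Qed.

End Splitting.
End ExtensionAlgebra.

(** * Derivatives of [Phi(W)], curvature on [xi], and torsion *)

Section ExtensionConnection.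
Context {R : realType} {n : nat} {N : manifold R n} {E : extension_data N}.
Context {h : twoform (tangent_bundle N)} {Z : vfield N} {tau : oneform (tangent_bundle N)}.
Arguments tau : clear implicits.
Hypotheses (hN : is_lightlike_manifold h Z) (hE : is_lightlike_extension E)
  (hh : extends E h Z) (hS : Sforms Z tau).
Local Notation TN := (tangent_bundle N).
Local Notation TB := (tangent_vector_bundle (N := N)).
Local Notation T := (ext_bundle E).
Local Notation H := (@ext_metric _ _ _ E _).
Local Notation Phi := (@Defs.Phi _ _ _ E _).
Local Notation D := (@ext_conn _ _ _ E).
Local Notation xi := (@ext_xi _ _ _ E).
Local Notation An := (@An_component _ _ _ E tau _).
Local Notation P := (Pproj Z tau).
Implicit Types (V W X Y : vfield N).

Lemma Phifield_smooth X : smooth_vfield X -> smooth_section (Phifield E X).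
Proof. by move=> SX; exact: (connection_smooth (ext_connection hE) SX (ext_xi_smooth hE)). Qed.

Lemma Phifield_split W :
  Phifield E W = fun q => tau q (W q) *: xi q + Phifield E (P W) q.
Proof.
apply: functional_extensionality_dep => q; rewrite /Phifield /Pproj PhiB// PhiZ// (Phi_Z hh).
by rewrite addrC subrK.
Qed.

Lemma conn_Phifield W p (v : TN p) : smooth_vfield W ->
  D (Phifield E W) p v =
  (dfun (fun q => tau q (W q)) v *: xi p + tau p (W p) *: Phi v) + D (Phifield E (P W)) p v.
Proof.
move=> SW; have cE := ext_connection hE; have Sxi := ext_xi_smooth hE.
have vB := ext_vector_bundle hE.
have Stau : smooth_fun (fun q => tau q (W q)).
  by case: hS => St _; exact (smooth_pairing TB St SW).
have [SPW _] := Anfield_Pproj hN hS SW.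
rewrite {1}Phifield_split (connection_add cE); last 2 first.
- exact: (smooth_sectionZ vB Stau Sxi).
- exact: Phifield_smooth.
by rewrite (connection_leibniz cE).
Qed.

Local Notation AnL := (An_component_linear hE hh hS).

(** The right side is the Galilean derivative of [W] along [V] without its [Z] term; this links
    curvature to torsion. *)
Lemma An_conn V W p : smooth_vfield W ->
  An (D (Phifield E W) p (V p)) = tau p (W p) *: P V p + nabla E tau V (P W) p.
Proof.
move=> SW; rewrite conn_Phifield// !(linmapD (@AnL p)) (An_component_xi hE hh hS).
by rewrite (linmapZ (@AnL p)) (An_component_Phi hE hh hS) add0r.
Qed.

Lemma tau_An p (y : T p) : tau p (An y) = 0.
Proof. by case: (An_componentP hE hh hS y). Qed.

Lemma An_curvature V W p : smooth_vfield V -> smooth_vfield W ->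
  An (curvature D V W xi p) =
  (tau p (W p) *: P V p + nabla E tau V (P W) p) -
  (tau p (V p) *: P W p + nabla E tau W (P V) p) - P (lie_bracket V W) p.
Proof.
move=> SV SW; rewrite -!An_conn// /Pproj -(An_component_Phi hE hh hS).
by rewrite -!(linmapB (@AnL p)).
Qed.

Lemma Pproj_torsion V W p : smooth_vfield V -> smooth_vfield W ->
  P (torsion E Z tau V W) p = An (curvature D V W xi p).
Proof.
move=> SV SW; have tS := @Sforms_scalar _ _ _ _ _ hS p; have tZ := Sforms_Z hS p.
rewrite An_curvature//.
(* Apart from its explicit [Z] term the Galilean derivative lies in An(tau), so [P] fixes it and
   removes that term. *)
have tG V' W' : tau p (tau p (W' p) *: P V' p + nabla E tau V' (P W') p) = 0.
  rewrite (functionalD tS) (functionalZ tS) /Pproj (functionalB tS) (functionalZ tS) tZ.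
  by rewrite mulr1 subrr mulr0 add0r; exact: tau_An.
have GE V' W' : galilean E Z tau V' W' p = dfun (fun q => tau q (W' q)) (V' p) *: Z p +
    (tau p (W' p) *: P V' p + nabla E tau V' (P W') p) by rewrite addrA.
rewrite {1}/Pproj /torsion !GE; move: (dfun _ _) (dfun _ _) (tG V W) (tG W V).
move: (_ + _) (_ + _) => A A' a b tA tA'.
rewrite /Pproj; move: (lie_bracket V W p) => L.
rewrite !(functionalB tS) !(functionalD tS) !(functionalZ tS) tZ tA tA' !mulr1 !addr0.
move: (tau p L) (Z p) => l z.
by apply/rowP => j; rewrite !mxE; ring.
Qed.

(** Differentiate [H(xi, Phi(W)) = 0]. The result is symmetric in [V] and [W], so the two second
    derivatives cancel in [H(xi, R(V,W) xi)]. *)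
Lemma metric_xi_conn_Phi V W p : smooth_vfield W ->
  H (xi p) (D (Phifield E W) p (V p)) = - H (Phi (V p)) (Phi (W p)).
Proof.
move=> SW; have := ext_metric_connection hE (V p) (ext_xi_smooth hE) (Phifield_smooth SW).
have -> : (fun q => H (xi q) (Phifield E W q)) = fun=> 0.
  by apply/funext => q; exact: metric_xi_Phi.
by rewrite dfun_cst => /esym/eqP; rewrite addrC addr_eq0 => /eqP.
Qed.

Lemma metric_xi_curvature V W p : smooth_vfield V -> smooth_vfield W ->
  H (xi p) (curvature D V W xi p) = 0.
Proof.
move=> SV SW; have HS := @ext_metric_scalar _ _ _ _ hE p (xi p).
have -> : H (xi p) (curvature D V W xi p) = H (xi p) (D (Phifield E W) p (V p)) -
    H (xi p) (D (Phifield E V) p (W p)) - H (xi p) (Phi (lie_bracket V W p)).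
  by rewrite -!(functionalB HS).
rewrite !metric_xi_conn_Phi// (metric_xi_Phi hE) subr0.
by rewrite (ext_metricC hE) subrr.
Qed.

Lemma curvature_collinearP : curvature_xi_collinear E <->
  forall V W, smooth_vfield V -> smooth_vfield W -> forall p,
    An (curvature D V W xi p) = 0.
Proof.
split=> [C V W SV SW p|C V W SV SW].
  by have [f ->] := C V W SV SW; exact: (An_component_xi hE hh hS).
have /choice [f Hf] : forall p, exists a : R, curvature D V W xi p = a *: xi p.
  move=> p; have [_ [a]] := An_componentP hE hh hS (curvature D V W xi p).
  rewrite C// metric_xi_curvature// (Phi0 hE) scale0r !addr0 => e.
  by exists a.
by exists f.
Qed.

(** The summand [X] arises from [Phi(Z) = xi]: the derivative of [Phi(Z)] along [X] is [Phi(X)]. *)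
Lemma collinear_nabla_Z X p : curvature_xi_collinear E -> Anfield tau X ->
  nabla E tau Z X p = X p + P (lie_bracket Z X) p.
Proof.
move=> /curvature_collinearP C [SX tX]; case: (hN) => _ SZ _ _ _.
have := C Z X SZ SX p.
have -> : An (curvature D Z X xi p) = An (D (Phifield E X) p (Z p)) -
    An (D (Phifield E Z) p (X p)) - An (Phi (lie_bracket Z X p)).
  by rewrite -!(linmapB (@AnL p)).
have -> : Phifield E Z = xi by apply: functional_extensionality_dep => q; exact: (Phi_Z hh).
rewrite -/(Phi (X p)) !(An_component_Phi hE hh hS) tX scale0r subr0.
by rewrite -addrA -opprD => /subr0_eq.
Qed.

Lemma collinear_nabla_torsion X Y p : curvature_xi_collinear E ->
  Anfield tau X -> Anfield tau Y ->
  nabla E tau X Y p - nabla E tau Y X p - P (lie_bracket X Y) p = 0.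
Proof.
move=> /curvature_collinearP C [SX tX] [SY tY].
rewrite -[RHS](C X Y SX SY p) /Pproj -(An_component_Phi hE hh hS).
by rewrite -!(linmapB (@AnL p)).
Qed.

Lemma nabla_split W X p : smooth_vfield X ->
  nabla E tau W X p = tau p (W p) *: nabla E tau Z X p + nabla E tau (P W) X p.
Proof.
move=> SX; have LD := connection_linear (ext_connection hE) (p := p) (Phifield_smooth SX).
rewrite /nabla /cov -(linmapZ (@AnL p)) -(linmapD (@AnL p)) -(linmapZ LD) -(linmapD LD).
by congr (An (D _ _ _)); rewrite /Pproj addrC subrK.
Qed.

Lemma metric_nabla W X Y p : smooth_vfield W -> Anfield tau X -> Anfield tau Y ->
  dfun (fun q => h (X q) (Y q)) (W p) =
  h (nabla E tau W X p) (Y p) + h (X p) (nabla E tau W Y p).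
Proof.
move=> SW [SX tX] [SY tY]; have hE' := hE; case: (hh) => hP _.
(* For [v] in An(tau) both [xi] and [eta] are orthogonal to [Phi v], so only the An-component of [y]
   contributes. *)
have key y v : tau p v = 0 -> h (An y) v = H y (Phi v).
  move=> tv; have [_ [a {2}->]] := An_componentP hE hh hS y.
  have [_ _ eP] := eta_spec hE hh hS p.
  rewrite hP ![H _ (Phi v)](ext_metricC hE).
  have HS := @ext_metric_scalar _ _ _ _ hE p (Phi v).
  rewrite !(functionalD HS) !(functionalZ HS) eP tv mulr0 addr0.
  by rewrite [H (Phi v) (xi p)](ext_metricC hE) (metric_xi_Phi hE) mulr0 add0r.
have -> : (fun q => h (X q) (Y q)) = fun q => H (Phifield E X q) (Phifield E Y q).
  by apply/funext => q; rewrite hP.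
rewrite (ext_metric_connection hE _ (Phifield_smooth SX) (Phifield_smooth SY)).
rewrite key//; congr (_ + _).
rewrite (ext_metricC hE) -key//; case: (hN) => -[_ hC _] _ _ _ _; exact: hC.
Qed.

End ExtensionConnection.

(** * Brackets modulo [Z], the passage from (2) to (3), and uniqueness *)

Section Equivalence.
Context {R : realType} {n : nat} {N : manifold R n} {E : extension_data N}.
Context {h : twoform (tangent_bundle N)} {Z : vfield N} {tau : oneform (tangent_bundle N)}.
Arguments tau : clear implicits.
Hypotheses (hN : is_lightlike_manifold h Z) (hE : is_lightlike_extension E)
  (hh : extends E h Z) (hS : Sforms Z tau).
Local Notation TN := (tangent_bundle N).
Local Notation P := (Pproj Z tau).
Implicit Types (V W X Y : vfield N).

Lemma Pproj_bracketl V W p : smooth_vfield V ->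
  P (lie_bracket V W) p =
  tau p (V p) *: P (lie_bracket Z W) p + P (lie_bracket (P V) W) p.
Proof.
move=> SV; have tS := @Sforms_scalar _ _ _ _ _ hS p; have tZ := Sforms_Z hS p.
case: (hN) => _ SZ _ _ _; have [SPV _] := Anfield_Pproj hN hS SV.
have Stau : smooth_fun (fun q => tau q (V q)).
  by case: (hS) => St _; exact (smooth_pairing tangent_vector_bundle St SV).
have StZ := smooth_sectionZ tangent_vector_bundle Stau SZ.
have VE : V = fun q => tau q (V q) *: Z q + P V q.
  by apply/funext => q; rewrite /Pproj addrC subrK.
have e1 : lie_bracket V W p = lie_bracket (fun q => tau q (V q) *: Z q) W p +
    lie_bracket (P V) W p by rewrite {1}VE lie_bracketDl.
have [g e2] := lie_bracketZl W p Stau SZ.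
pose pr (v : TN p) : TN p := v - tau p v *: Z p.
change (pr (lie_bracket V W p) = tau p (V p) *: pr (lie_bracket Z W p) +
  pr (lie_bracket (P V) W p)).
rewrite e1 e2 /pr.
move: (lie_bracket Z W p) (lie_bracket (P V) W p) (tau p (V p)) => x y a.
rewrite (functionalD tS) (functionalB tS) !(functionalZ tS) tZ.
move: (tau p x) (tau p y) (Z p) => s t z.
by apply/rowP => j; rewrite !mxE; ring.
Qed.

Lemma PprojC V W p : P (lie_bracket V W) p = - P (lie_bracket W V) p.
Proof.
have tS := @Sforms_scalar _ _ _ _ _ hS p.
rewrite /Pproj lie_bracketC; move: (lie_bracket W V p) => x.
by rewrite -[in LHS]scaleN1r (functionalZ tS) mulN1r scaleN1r scaleNr opprK opprB addrC.
Qed.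

(** Only the [Z] components are split off, so the derivatives of the coefficients are multiples of
    [Z] and disappear under [P]. Skew-symmetry then transfers the splitting from the first argument
    to the second. *)
Lemma Pproj_bracket V W p : smooth_vfield V -> smooth_vfield W ->
  P (lie_bracket V W) p = tau p (V p) *: P (lie_bracket Z (P W)) p
    - tau p (W p) *: P (lie_bracket Z (P V)) p + P (lie_bracket (P V) (P W)) p.
Proof.
move=> SV SW.
pose b U U' : TN p := P (lie_bracket U U') p.
change (b V W = tau p (V p) *: b Z (P W) - tau p (W p) *: b Z (P V) + b (P V) (P W)).
have bC U U' : b U U' = - b U' U by exact: PprojC.
have bl U U' : smooth_vfield U -> b U U' = tau p (U p) *: b Z U' + b (P U) U'.
  exact: Pproj_bracketl.
move: b bC bl => b bC bl.
have bZZ : b Z Z = 0.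
  have : b Z Z *+ 2 = 0 by rewrite mulr2n {1}bC addNr.
  by move/eqP; rewrite -scaler_nat scaler_eq0 pnatr_eq0 => /eqP.
have bZ : b Z W = b Z (P W) by rewrite bC bl// bZZ scaler0 add0r -bC.
have bP : b (P V) W = - (tau p (W p) *: b Z (P V)) + b (P V) (P W).
  by rewrite bC bl// opprD -bC.
by rewrite bl// bZ bP addrA.
Qed.

Lemma Pproj_torsion_nabla :
  (forall X, Anfield tau X -> forall p,
     nabla E tau Z X p = X p + P (lie_bracket Z X) p) ->
  (forall X Y, Anfield tau X -> Anfield tau Y -> forall p,
     nabla E tau X Y p - nabla E tau Y X p - P (lie_bracket X Y) p = 0) ->
  forall V W, smooth_vfield V -> smooth_vfield W -> forall p,
    P (torsion E Z tau V W) p = 0.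
Proof.
move=> nZ nT V W SV SW p; have AV := Anfield_Pproj hN hS SV; have AW := Anfield_Pproj hN hS SW.
have [[SPV _] [SPW _]] := (AV, AW).
rewrite (Pproj_torsion hN hE hh hS)// (An_curvature hN hE hh hS)//.
rewrite (nabla_split hE hh hS V p SPW) (nabla_split hE hh hS W p SPV) !nZ//.
rewrite (Pproj_bracket p SV SW).
(* Here [a], [b] are [tau(V)], [tau(W)]; [x], [y] are [P V], [P W]; [A], [B], [C] are the projected
   brackets of [Z] with [P W], of [Z] with [P V], and of [P V] with [P W]. The premise is (2.2). *)
have arith (a b : R) (x y A B C s t : TN p) : s - t - C = 0 ->
    b *: x + (a *: (y + A) + s) - (a *: y + (b *: (x + B) + t)) -
    (a *: A - b *: B + C) = 0.
  by move=> /subr0_eq <-; apply/rowP => j; rewrite !mxE; ring.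
exact: arith (nT _ _ AV AW p).
Qed.

Section Uniqueness.
Context {E' : extension_data N}.
Hypotheses (hE' : is_lightlike_extension E') (hh' : extends E' h Z)
  (C : curvature_xi_collinear E) (C' : curvature_xi_collinear E').

(* The difference of two metric torsion-free connections is symmetric in its
   first two arguments and skew in its last two, hence vanishes. *)
Lemma nabla_unique_An X Y p : Anfield tau X -> Anfield tau Y ->
  nabla E tau X Y p = nabla E' tau X Y p.
Proof.
move=> AX AY; have tS := @Sforms_scalar _ _ _ _ _ hS p.
case: (hN) => -[hL hC _] _ _ _ _.
pose A V W : TN p := nabla E tau V W p - nabla E' tau V W p.
have arith (s t s' t' L : TN p) : s - t - L = 0 -> s' - t' - L = 0 -> s - s' = t - t'.
  move=> /subr0_eq e /subr0_eq e'; have -> : s = t + L by rewrite -e addrC subrK.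
  have -> : s' = t' + L by rewrite -e' addrC subrK.
  by rewrite opprD addrACA subrr addr0.
have Asym V W : Anfield tau V -> Anfield tau W -> A V W = A W V.
  move=> AV AW; exact: arith (collinear_nabla_torsion hE hh hS p C AV AW)
    (collinear_nabla_torsion hE' hh' hS p C' AV AW).
have Askew V W U : smooth_vfield V -> Anfield tau W -> Anfield tau U ->
    h (A V W) (U p) = - h (A V U) (W p).
  move=> SV AW AU; have e := metric_nabla hN hE hh hS p SV AW AU.
  have := etrans (esym e) (metric_nabla hN hE' hh' hS p SV AW AU).
  rewrite /A; move: (nabla E tau V W p) (nabla E' tau V W p) => s s'.
  move: (nabla E tau V U p) (nabla E' tau V U p) => t t'.
  rewrite !(hC p _ (U p)) !(hC p (t - t')) !(functionalB (hL p _)).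
  move=> e1; apply/eqP; rewrite -subr_eq0 opprK -addrACA -opprD subr_eq0 -e1 eqxx.
  by [].
have skew3 U : Anfield tau U -> h (A X Y) (U p) = 0.
  move=> AU; have [[SX _] [SY _] [SU _]] := And3 AX AY AU.
  (* Three skew swaps alternate with three symmetric ones and return to the original order with the
     opposite sign. *)
  have e : h (A X Y) (U p) = - h (A X Y) (U p).
    rewrite {1}(Askew _ _ _ SX AY AU) (Asym _ _ AX AU) (Askew _ _ _ SU AX AY) opprK.
    by rewrite (Asym _ _ AU AY) (Askew _ _ _ SY AU AX) (Asym _ _ AY AX).
  have /eqP : h (A X Y) (U p) *+ 2 = 0 by rewrite mulr2n {1}e addNr.
  by rewrite mulrn_eq0 => /eqP.
have tA : tau p (A X Y) = 0.
  by rewrite (functionalB tS) (tau_An hE hh hS) (tau_An hE' hh' hS) subrr.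
(* Extending the vector [A X Y] to a field and projecting it to An(tau) allows [U p = A X Y], so its
   square under [h] vanishes. *)
have [V [SV VA]] := exists_smooth_vfield (A X Y).
apply/subr0_eq; apply: (lightlike_definite hN hS (v := A X Y)); last exact: tA.
have := skew3 _ (Anfield_Pproj hN hS SV).
by rewrite /Pproj VA tA scale0r subr0.
Qed.

(** Along [Z] the derivative is prescribed by (2.1); the remaining direction [P W] lies in
    An(tau). *)
Lemma nabla_unique W X p : smooth_vfield W -> Anfield tau X ->
  nabla E tau W X p = nabla E' tau W X p.
Proof.
move=> SW AX; have [SX _] := AX.
rewrite (nabla_split hE hh hS W p SX) (nabla_split hE' hh' hS W p SX).
rewrite (collinear_nabla_Z hN hE hh hS p C AX) (collinear_nabla_Z hN hE' hh' hS p C' AX).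
by rewrite (nabla_unique_An p (Anfield_Pproj hN hS SW) AX).
Qed.

End Uniqueness.
End Equivalence.

Theorem proposition7p1 (R : realType) (m : nat) (hm : (2 <= m)%N)
    (N : manifold R m.+1) (h : twoform (tangent_bundle N)) (Z : vfield N)
    (hN : is_lightlike_manifold h Z) :
  (forall E : extension_data N, is_lightlike_extension E -> extends E h Z ->
    [<-> curvature_xi_collinear E;
         forall tau, Sforms Z tau ->
           (forall X, Anfield tau X -> forall p,
              nabla E tau Z X p = X p + Pproj Z tau (lie_bracket Z X) p) /\
           (forall X Y, Anfield tau X -> Anfield tau Y -> forall p,
              nabla E tau X Y p - nabla E tau Y X p
              - Pproj Z tau (lie_bracket X Y) p = 0);
         forall tau, Sforms Z tau ->
           forall V W, smooth_vfield V -> smooth_vfield W -> forall p,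
             Pproj Z tau (torsion E Z tau V W) p = 0])
  /\
  (forall E E' : extension_data N,
    is_lightlike_extension E -> extends E h Z ->
    is_lightlike_extension E' -> extends E' h Z ->
    curvature_xi_collinear E -> curvature_xi_collinear E' ->
    forall tau, Sforms Z tau ->
    forall W X, smooth_vfield W -> Anfield tau X -> forall p,
      nabla E tau W X p = nabla E' tau W X p).
Proof.
split=> [E hE hh|E E' hE hh hE' hh' C C' tau hS W X SW AX p]; last first.
  exact: (nabla_unique hN hE hh hS hE' hh' C C' p SW AX).
tfae.
- move=> C tau hS; split=> [X AX p|X Y AX AY p].
    exact: (collinear_nabla_Z hN hE hh hS p C AX).
  exact: (collinear_nabla_torsion hE hh hS p C AX AY).
- move=> H tau hS; have [nZ nT] := H tau hS.
  exact: (Pproj_torsion_nabla hN hE hh hS nZ nT).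
- move=> H; have [_ SZ _ Z0 _] := hN; have [tau hS] := exists_Sforms SZ Z0.
  apply/(curvature_collinearP hE hh hS) => V W SV SW p.
  by rewrite -(Pproj_torsion hN hE hh hS)//; exact: H.
Qed.
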